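(* Every irreducible unitary representation of the topological group $\mathcal G$ is induced from a unitary representation of some group $\widehat{\mathcal G}[L]$, where $L\subset\mathfrak l$ is a finitely generated submodule, that is trivial on the subgroup $\mathcal G^\circ[L]$.
   Context: Let $p>2$ be a prime, $n\ge1$, $R:=\mathbb Z/p^n\mathbb Z$. Let $\mathfrak l$ be the $R$-module of all sequences (row vectors) $v=(v_1,v_2,\dots)$ over $R$ with $v_j=0$ for all sufficiently large $j$, with the discrete topology; $e_j$ are the standard basis vectors. $\mathcal G$ is the group of all infinite matrices $g$ over $R$ (indexed by $\mathbb N$) such that each row of $g$ contains only finitely many nonzero elements, and $g^{-1}$ exists and has the same property. It acts on $\mathfrak l$ by $v\mapsto vg$. A sequence $g^{(\alpha)}\in\mathcal G$ converges to $g$ if for each $j$ the sequence $e_jg^{(\alpha)}$ is eventually constant with value $e_jg$ (the topology of pointwise stabilizers of finite subsets of $\mathfrak l$). Unitary representations are strongly continuous. For a finitely generated submodule $L\subset\mathfrak l$, $\widehat{\mathcal G}[L]$ is the subgroup of all $g\in\mathcal G$ sending $L$ to itself, and $\mathcal G^\circ[L]$ is the subgroup of all $g\in\mathcal G$ fixing $L$ pointwise. Induced representation: for an open subgroup $Q\subset\mathcal G$ and a unitary representation $\nu$ of $Q$ in $V$, the induced representation acts in the Hilbert space of $\ell^2$-functions $f:Q\backslash\mathcal G\to V$ by $(\rho(g)f)(x)=U(g,x)f(xg)$; here one chooses $s(x)\in\mathcal G$ with $x_0s(x)=x$ ($x_0$ the initial point) and sets $U(g,x)=\nu(q)$, where $q\in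 Q$ is determined by $s(x)g=q\,s(xg)$. It is well defined up to unitary equivalence. *)

(* Defs.v *)
From HB Require Import structures.
From mathcomp Require Import all_boot all_order all_algebra.
From mathcomp Require Import all_classical all_reals all_analysis.
From mathcomp Require Import sesquilinear complex.

Set Implicit Arguments.
Unset Strict Implicit.
Unset Printing Implicit Defensive.

Import Order.TTheory GRing.Theory Num.Theory.
Import numFieldNormedType.Exports.

Local Open Scope classical_set_scope.
Local Open Scope ring_scope.

HB.mixin Record isTopologicalGroup G of Group G & Topological G := {
  mulg_continuous : continuous (fun x : G * G => (x.1 * x.2)%g);
  invg_continuous : continuous (fun x : G => x^-1%g)
}.

#[short(type="topGroupType")]
HB.structure Definition TopGroup :=
  {G of Group G & Topological G & isTopologicalGroup G}.

Definition subgroup (G : groupType) (Q : set G) :=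
  [/\ Q 1%g, forall g h, Q g -> Q h -> Q (g * h)%g &
      forall g, Q g -> Q (g^-1)%g].

(* As in sesquilinear.v, the inner product is linear in its first argument. *)
HB.mixin Record isHilbert (K : realType) H of CompleteNormedModule K[i] H := {
  inner : {dot H for (@Num.conj K[i])};
  sqr_norm_inner : forall v : H, `|v| ^+ 2 = inner v v
}.

#[short(type="hilbertType")]
HB.structure Definition Hilbert (K : realType) :=
  {H of CompleteNormedModule K[i] H & isHilbert K H}.

Section UnitaryRepresentations.
Variables (K : realType) (G : topGroupType).

(* [nu] represents the subgroup [Q] of [G]: its values outside [Q] are
   irrelevant. *)
Definition unitary_rep (Q : set G) (V : hilbertType K)
    (nu : G -> {linear V -> V}) :=
  [/\ forall v, nu 1%g v = v,
      forall g h v, Q g -> Q h -> nu (g * h)%g v = nu g (nu h v),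
      forall g u v, Q g -> inner (nu g u) (nu g v) = inner u v &
      forall v, {within Q, continuous (fun g => nu g v)}].

Definition irreducible (H : hilbertType K) (rho : G -> {linear H -> H}) :=
  (exists v : H, v != 0) /\
  forall W : set H, closed W ->
    W 0 -> (forall a u v, W u -> W v -> W (a *: u + v)) ->
    (forall g v, W v -> W (rho g v)) ->
    W = [set 0] \/ W = setT.

Section Induction.
Variable Q : set G.

(* The homogeneous space Q \ G of the cosets Q g, on which G acts on the
   right; the initial point is Q itself. *)
Definition cosets : set (set G) :=
  range (fun g : G => [set (q * g)%g | q in Q]).

Lemma coset_mul_subproof (x : cosets) (g : G) :
  [set (h * g)%g | h in val x] \in cosets.
Proof.
case: x => x /= /set_mem[h _ <-]; apply/mem_set; exists (h * g)%g => //.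
by rewrite image_comp; apply: eq_imagel => q _ /=; rewrite mulgA.
Qed.

Definition coset_mul (x : cosets) (g : G) : cosets :=
  SigSub (coset_mul_subproof x g).

Lemma coset_rep_subproof (x : cosets) :
  exists g : G, [set (q * g)%g | q in Q] = val x.
Proof. by have /set_mem[g _ gx] := valP x; exists g. Qed.

(* A choice of s(x) with Q s(x) = x. *)
Definition coset_rep (x : cosets) : G := projT1 (cid (coset_rep_subproof x)).

(* The element q of [Q] such that s(x) g = q s(x g). *)
Definition coset_cocycle (g : G) (x : cosets) : G :=
  (coset_rep x * g * (coset_rep (coset_mul x g))^-1)%g.

Variable V : hilbertType K.

Definition ell2_sqnorm (f : cosets -> V) : \bar K :=
  \esum_(x in [set: cosets]) (complex.Re `|f x| ^+ 2)%:E.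

Definition ell2 : set (cosets -> V) := [set f | (ell2_sqnorm f < +oo)%E].

Definition ind_act (nu : G -> {linear V -> V}) (g : G) (f : cosets -> V) :
    cosets -> V :=
  fun x => nu (coset_cocycle g x) (f (coset_mul x g)).

(* [T] is a unitary operator from [H] onto the Hilbert space of square
   summable functions on Q \ G that intertwines [rho] with the representation
   induced from [nu]. *)
Definition induced_from (nu : G -> {linear V -> V})
    (H : hilbertType K) (rho : G -> {linear H -> H}) :=
  exists T : {linear H -> (cosets -> V)},
    [/\ range T = ell2,
        forall v, ell2_sqnorm (T v) = (complex.Re `|v| ^+ 2)%:E &
        forall g v, T (rho g v) = ind_act nu g (T v)].

End Induction.
End UnitaryRepresentations.

Section FinitelySupportedSequences.
Variable A : comNzRingType.

Definition eventually_zero (v : nat -> A) : bool :=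
  `[< exists N, forall j, (N <= j)%N -> v j = 0 >].

Record fseq := Fseq { fseq_val :> nat -> A; _ : eventually_zero fseq_val }.

HB.instance Definition _ := [isSub for fseq_val].
HB.instance Definition _ := [Choice of fseq by <:].

Lemma eventually_zero_closed : zmod_closed eventually_zero.
Proof.
split=> [|u v /asboolP[M uM] /asboolP[N vN]]; apply/asboolP; first by exists 0%N.
exists (maxn M N) => j; rewrite geq_max => /andP[Mj Nj].
by rewrite [LHS]/= [LHS]/GRing.add/= uM// add0r [LHS]/GRing.opp/= vN// oppr0.
Qed.

HB.instance Definition _ :=
  GRing.SubChoice_isSubZmodule.Build (nat -> A) eventually_zero fseq
    eventually_zero_closed.

Lemma fseqP (u v : fseq) : (forall j, u j = v j) -> u = v.
Proof. by move=> uv; apply/val_inj/funext. Qed.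

Lemma fseq_bound (v : fseq) : exists N, forall j, (N <= j)%N -> v j = 0.
Proof. by case: v => v /= /asboolP. Qed.

Lemma fseqDE (u v : fseq) j : (u + v) j = u j + v j.
Proof. by []. Qed.

Lemma fseq_scale_subproof a (v : fseq) : eventually_zero (fun j => a * v j).
Proof.
have [N vN] := fseq_bound v; apply/asboolP; exists N => j /vN ->.
by rewrite mulr0.
Qed.

Definition fseq_scale a (v : fseq) : fseq := Fseq (fseq_scale_subproof a v).

Lemma fseq_scaleA a b v : fseq_scale a (fseq_scale b v) = fseq_scale (a * b) v.
Proof. by apply: fseqP => j /=; rewrite mulrA. Qed.

Lemma fseq_scale1 : left_id 1 fseq_scale.
Proof. by move=> v; apply: fseqP => j /=; rewrite mul1r. Qed.

Lemma fseq_scaleDr : right_distributive fseq_scale +%R.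
Proof. by move=> a u v; apply: fseqP => j; exact: mulrDr. Qed.

Lemma fseq_scaleDl v : {morph fseq_scale^~ v : a b / a + b}.
Proof. by move=> a b; apply: fseqP => j; exact: mulrDl. Qed.

HB.instance Definition _ := GRing.Zmodule_isLmodule.Build A fseq
  fseq_scaleA fseq_scale1 fseq_scaleDr fseq_scaleDl.

Lemma fseqZE a (v : fseq) j : (a *: v) j = a * v j.
Proof. by []. Qed.

Lemma fseq_sumE n (F : 'I_n -> fseq) j :
  (\sum_(i < n) F i) j = \sum_(i < n) F i j.
Proof.
by elim/big_ind2: _ => // u a v b <- <-.
Qed.

Lemma fbasis_subproof i : eventually_zero (fun j => (i == j)%:R).
Proof.
by apply/asboolP; exists i.+1 => j ij; rewrite (ltn_eqF ij).
Qed.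

Definition fbasis i : fseq := Fseq (fbasis_subproof i).

Definition span k (u : 'I_k -> fseq) : set fseq :=
  range (fun a : 'I_k -> A => \sum_(i < k) a i *: u i).

Definition fg_submodule (L : set fseq) :=
  exists k (u : 'I_k -> fseq), L = span u.

(* The matrix [g] whose row [i] is [g i] and whose entries are [g i j]. *)
Definition rfmatrix := nat -> fseq.

(* The row vector [v g], i.e. the finite sum of the [v i *: g i]. *)
Definition vmul (v : fseq) (g : rfmatrix) : fseq :=
  \sum_(i \in [set: nat]) v i *: g i.

Definition rfmul (g h : rfmatrix) : rfmatrix := fun i => vmul (g i) h.

Definition rfone : rfmatrix := fbasis.

Lemma vmulE N (v : fseq) g : (forall j, (N <= j)%N -> v j = 0) ->
  vmul v g = \sum_(i < N) v i *: g i.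
Proof.
move=> vN; rewrite (fsbig_ord _ _ (fun i => v i *: g i)) /vmul.
apply/esym/fsbig_widen => // i /= -[_ /negP]; rewrite -leqNgt => Ni.
by rewrite vN// scale0r.
Qed.

Lemma vmulP (v : fseq) g : exists N, (forall j, (N <= j)%N -> v j = 0) /\
  vmul v g = \sum_(i < N) v i *: g i.
Proof. by have [N vN] := fseq_bound v; exists N; split=> //; exact: vmulE. Qed.

Lemma vmul_is_linear g : linear (vmul ^~ g).
Proof.
move=> a u v; have [M uM] := fseq_bound u; have [N vN] := fseq_bound v.
have uMN j : (maxn M N <= j)%N -> u j = 0.
  by rewrite geq_max => /andP[/uM].
have vMN j : (maxn M N <= j)%N -> v j = 0.
  by rewrite geq_max => /andP[_ /vN].
rewrite !(@vmulE (maxn M N))// => [|j jMN]; last first.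
  by rewrite fseqDE fseqZE uMN// vMN// mulr0 addr0.
rewrite scaler_sumr -big_split; apply: eq_bigr => i _.
by rewrite fseqDE fseqZE scalerDl scalerA.
Qed.

Lemma vmul_sum n (a : 'I_n -> A) (u : 'I_n -> fseq) g :
  vmul (\sum_(i < n) a i *: u i) g = \sum_(i < n) a i *: vmul (u i) g.
Proof.
apply: (big_rec2 (fun x y => vmul x g = y)) => [|i x _ _ <-]; last first.
  exact: vmul_is_linear.
by rewrite (@vmulE 0)// big_ord0.
Qed.

Lemma vmul_basis i g : vmul (fbasis i) g = g i.
Proof.
rewrite (@vmulE i.+1) => [|j ij]; last by rewrite /= (ltn_eqF ij).
rewrite big_ord_recr/= eqxx scale1r big1 ?add0r// => j _.
by rewrite gtn_eqF// scale0r.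
Qed.

Lemma vmul1 v : vmul v rfone = v.
Proof.
have [N [vN ->]] := vmulP v rfone; apply: fseqP => j; rewrite fseq_sumE.
have [Nj|jN] := leqP N j.
  rewrite vN// big1// => i _.
  by rewrite [LHS]fseqZE /= (ltn_eqF (leq_trans _ Nj))// mulr0.
rewrite (bigD1 (Ordinal jN))//= big1 => [|i ij].
  by rewrite addr0 /= eqxx mulr1.
by rewrite /= (negbTE (_ : i != j :> nat))// mulr0.
Qed.

Lemma vmulA v g h : vmul v (rfmul g h) = vmul (vmul v g) h.
Proof.
have [N [vN ->]] := vmulP v g.
by rewrite vmul_sum (vmulE _ vN).
Qed.

Lemma rfmulA : associative rfmul.
Proof. by move=> f g h; apply/funext => i; rewrite /rfmul vmulA. Qed.

Lemma rfmul1 : right_id rfone rfmul.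
Proof. by move=> g; apply/funext => i; exact: vmul1. Qed.

Lemma rf1mul : left_id rfone rfmul.
Proof. by move=> g; apply/funext => i; exact: vmul_basis. Qed.

Definition rfinvertible (g : rfmatrix) : bool :=
  `[< exists h, rfmul g h = rfone /\ rfmul h g = rfone >].

Record rfGL := RfGL { rfGL_val :> rfmatrix; _ : rfinvertible rfGL_val }.

HB.instance Definition _ := [isSub for rfGL_val].
HB.instance Definition _ := gen_eqMixin rfGL.
HB.instance Definition _ := gen_choiceMixin rfGL.

Lemma rfGLP (g : rfGL) :
  exists h, rfmul g h = rfone /\ rfmul h g = rfone.
Proof. by case: g => g /= /asboolP. Qed.

Lemma rfGL_one_subproof : rfinvertible rfone.
Proof. by apply/asboolP; exists rfone; rewrite rfmul1. Qed.

Lemma rfGL_mul_subproof (g h : rfGL) : rfinvertible (rfmul g h).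
Proof.
have [g' [gg' g'g]] := rfGLP g; have [h' [hh' h'h]] := rfGLP h.
apply/asboolP; exists (rfmul h' g'); split.
  by rewrite rfmulA -(rfmulA g) hh' rfmul1.
by rewrite rfmulA -(rfmulA h') g'g rfmul1.
Qed.

Lemma rfGL_inv_subproof (g : rfGL) : rfinvertible (projT1 (cid (rfGLP g))).
Proof. by case: cid => h /= [gh hg]; apply/asboolP; exists g. Qed.

Definition rfGL_one := RfGL rfGL_one_subproof.
Definition rfGL_mul g h := RfGL (rfGL_mul_subproof g h).
Definition rfGL_inv g := RfGL (rfGL_inv_subproof g).

Lemma rfGL_mulA : associative rfGL_mul.
Proof. by move=> f g h; apply: val_inj; exact: rfmulA. Qed.

Lemma rfGL_mul1g : left_id rfGL_one rfGL_mul.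
Proof. by move=> g; apply: val_inj; exact: rf1mul. Qed.

Lemma rfGL_mulg1 : right_id rfGL_one rfGL_mul.
Proof. by move=> g; apply: val_inj; exact: rfmul1. Qed.

Lemma rfGL_mulVg : left_inverse rfGL_one rfGL_inv rfGL_mul.
Proof. by move=> g; apply: val_inj => /=; case: cid => h []. Qed.

Lemma rfGL_mulgV : right_inverse rfGL_one rfGL_inv rfGL_mul.
Proof. by move=> g; apply: val_inj => /=; case: cid => h []. Qed.

HB.instance Definition _ :=
  isGroup.Build rfGL rfGL_mulA rfGL_mul1g rfGL_mulg1 rfGL_mulVg rfGL_mulgV.

Lemma vmulgM v (g h : rfGL) : vmul v (g * h)%g = vmul (vmul v g) h.
Proof. exact: vmulA. Qed.

Lemma vmulg1 v : vmul v (1%g : rfGL) = v.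
Proof. exact: vmul1. Qed.

Lemma vmulgK (g : rfGL) v : vmul (vmul v g) (g^-1)%g = v.
Proof. by rewrite -vmulgM mulgV vmulg1. Qed.

Lemma vmulgVK (g : rfGL) v : vmul (vmul v (g^-1)%g) g = v.
Proof. by rewrite -vmulgM mulVg vmulg1. Qed.

(* The open sets of the topology whose neighborhoods of [1] are generated by
   the pointwise stabilizers of finite sets of vectors. *)

Definition agree (F : seq fseq) (g : rfGL) : set rfGL :=
  [set h | forall v, v \in F -> vmul v h = vmul v g].

Definition rfGL_open (U : set rfGL) :=
  forall g, U g -> exists F, agree F g `<=` U.

Lemma rfGL_openT : rfGL_open setT.
Proof. by move=> g _; exists [::]. Qed.

Lemma rfGL_openI : setI_closed rfGL_open.
Proof.
move=> U W oU oW g [/oU[E EU] /oW[F FW]]; exists (E ++ F) => h EFh; split.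
  by apply: EU => v vE; apply: EFh; rewrite mem_cat vE.
by apply: FW => v vF; apply: EFh; rewrite mem_cat vF orbT.
Qed.

Lemma rfGL_open_bigU (I : Type) (f : I -> set rfGL) :
  (forall i, rfGL_open (f i)) -> rfGL_open (\bigcup_i f i).
Proof.
by move=> of_ g [i _ /of_[F Ff]]; exists F => h /Ff fh; exists i.
Qed.

HB.instance Definition _ :=
  isOpenTopological.Build rfGL rfGL_openT rfGL_openI rfGL_open_bigU.

Lemma nbhs_rfGL (g : rfGL) (U : set rfGL) :
  nbhs g U <-> exists F, agree F g `<=` U.
Proof.
split=> [[W [oW Wg WU]]|[F FU]].
  by have [F FW] := oW _ Wg; exists F; exact: subset_trans WU.
exists (agree F g); split=> // h gh; exists F => k hk v vF.
by rewrite hk// gh.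
Qed.

Lemma rfGL_mul_continuous :
  continuous (fun x : rfGL * rfGL => (x.1 * x.2)%g).
Proof.
move=> [g h] U /= /nbhs_rfGL[F FU].
exists (agree F g, agree [seq vmul v g | v <- F] h) => /=.
  by split; apply/nbhs_rfGL; eexists; exact: subset_refl.
move=> [g' h'] /= [Fg Fh]; apply: FU => v vF.
by rewrite !vmulgM (Fg v vF) (Fh (vmul v g) (map_f _ vF)).
Qed.

Lemma rfGL_inv_continuous : continuous (fun x : rfGL => (x^-1)%g).
Proof.
move=> g U /= /nbhs_rfGL[F FU]; apply/nbhs_rfGL.
exists [seq vmul v (g^-1)%g | v <- F] => h Fh; apply: FU => v vF.
rewrite -{1}[v](vmulgVK g) -(Fh (vmul v (g^-1)%g)) ?vmulgK//.
exact: map_f.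
Qed.

HB.instance Definition _ :=
  isTopologicalGroup.Build rfGL rfGL_mul_continuous rfGL_inv_continuous.

Lemma rfGL_cvg (u : nat -> rfGL) (g : rfGL) :
  (u @ \oo --> g) <->
  forall j, \forall n \near \oo, vmul (fbasis j) (u n) = vmul (fbasis j) g.
Proof.
split=> [ug j|ug U /nbhs_rfGL[F FU]].
  have gj : nbhs g (agree [:: fbasis j] g).
    by apply/nbhs_rfGL; exists [:: fbasis j].
  have : \forall n \near \oo, agree [:: fbasis j] g (u n) by exact: ug.
  by apply: filterS => n; apply; rewrite mem_head.
suff : \forall n \near \oo, agree F g (u n) by apply: filterS => n /FU.
elim: {U} F {FU} => [|v F IH]; first by exists 0%N.
have [N vN] := fseq_bound v.
have uN : \forall n \near \oo, forall j : 'I_N, rfGL_val (u n) j = rfGL_val g j.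
  apply: filter_forall => j; have := ug j; apply: filterS => n.
  by rewrite !vmul_basis.
near=> n; move=> w; rewrite inE => /orP[/eqP->|wF].
  rewrite !(vmulE _ vN); apply: eq_bigr => i _; congr (_ *: _).
  by have : forall j : 'I_N, rfGL_val (u n) j = rfGL_val g j by near: n.
have Fn : agree F g (u n) by near: n; exact: IH.
exact: Fn.
Unshelve. all: by end_near. Qed.

Definition setstab (L : set fseq) : set rfGL :=
  [set g | [set vmul v g | v in L] = L].

Definition ptstab (L : set fseq) : set rfGL :=
  [set g | forall v, L v -> vmul v g = v].

Lemma setstab_subgroup L : subgroup (setstab L).
Proof.
split=> [|g h gL hL|g gL]; rewrite /setstab/=.
- by rewrite (eq_imagel (f' := id)) ?image_id// => v _; exact: vmulg1.
- rewrite -[RHS]hL -[in RHS]gL image_comp.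
  by apply: eq_imagel => v _; exact: vmulgM.
- rewrite -[in LHS]gL image_comp (eq_imagel (f' := id)) ?image_id// => v _.
  exact: vmulgK.
Qed.

Lemma setstab_open L : fg_submodule L -> open (setstab L).
Proof.
move=> [k [u ->]]; change (rfGL_open (setstab (span u))) => g gL.
exists [seq u i | i <- enum 'I_k] => h hu; rewrite /setstab/= -[RHS]gL.
apply: eq_imagel => _ [a _ <-]; rewrite !vmul_sum.
by apply: eq_bigr => i _; rewrite hu// map_f// mem_enum.
Qed.

End FinitelySupportedSequences.

(* Main.v *)
Require Import Defs.
From HB Require Import structures.
From mathcomp Require Import all_boot all_order all_algebra.
From mathcomp Require Import all_classical all_reals all_analysis.
From mathcomp Require Import sesquilinear complex ring lra.
From mathcomp Require finmap.

Set Implicit Arguments.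
Unset Strict Implicit.
Unset Printing Implicit Defensive.

Import Order.TTheory GRing.Theory Num.Theory.
Import numFieldNormedType.Exports.

Local Open Scope classical_set_scope.
Local Open Scope ring_scope.

(* For a finite submodule L let H^L be the space of vectors fixed by the
   pointwise stabilizer of L. By continuity H^L <> 0 for some L; take such an L
   without proper submodule having this property. The key point is that H^L
   and H^M are orthogonal if H^N = 0 for N the intersection of L and M. Since
   Z/q is self-injective, isomorphisms between finite submodules extend to the
   whole group, so for u in H^L, w in H^M and g, k fixing N pointwise,
   <k^-1 w, g u> = <w, u> as soon as L g^-1 and M k meet in N, which holds for
   k in general position. On the other hand, the closed convex hull of the
   orbit of u under the stabilizer of N has an element of minimal norm, which
   is fixed, hence zero; so <w, u> = 0. Applied to the translates of L, this
   says that the translates of H^L indexed by the cosets of the stabilizer of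
   L are pairwise orthogonal; by irreducibility they span H, and rho is induced
   from its restriction to H^L. *)

(** * Z/q-linear algebra and extension of isomorphisms *)

Definition submod (A : nzRingType) (U : lmodType A) (L : set U) :=
  L 0 /\ forall a u v, L u -> L v -> L (a *: u + v).

Section Submod.
Variables (A : nzRingType) (U : lmodType A) (L : set U).
Hypothesis sL : submod L.

Lemma submod0 : L 0. Proof. by case: sL. Qed.

Lemma submodZ a u : L u -> L (a *: u).
Proof. by case: sL => L0 LP Lu; rewrite -[_ *: _]addr0; exact: LP. Qed.

Lemma submodD u v : L u -> L v -> L (u + v).
Proof. by case: sL => L0 LP Lu Lv; rewrite -[u]scale1r; exact: LP. Qed.

Lemma submod_sum I (r : seq I) (P : pred I) (F : I -> U) :
  (forall i, P i -> L (F i)) -> L (\sum_(i <- r | P i) F i).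
Proof. by move=> LF; elim/big_ind: _ => //; [exact: submod0 | exact: submodD]. Qed.

End Submod.

Lemma submodI (A : nzRingType) (U : lmodType A) (L M : set U) :
  submod L -> submod M -> submod (L `&` M).
Proof.
move=> [L0 LP] [M0 MP]; split=> // a u v [Lu Mu] [Lv Mv].
by split; [exact: LP | exact: MP].
Qed.

Lemma submod_pair (A : nzRingType) (U W : lmodType A) (G : set (U * W)) a x y x' y' :
  submod G -> G (x, y) -> G (x', y') -> G (a *: x + x', a *: y + y').
Proof. by case=> _ GP Gxy Gxy'; exact: (GP a (x, y) (x', y')). Qed.

Section Zq.
Variables (q : nat) (q_gt1 : (1 < q)%N).
Local Notation A := 'Z_q.

Lemma Zq_nat_eq0 k : (k%:R == 0 :> A) = (q %| k)%N.
Proof. by rewrite -val_eqE/= val_Zp_nat. Qed.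

(** The generator is the least positive integer whose class lies in [I]: division with remainder
    shows that it divides every such integer, in particular [q], whose class is 0. *)
Lemma Zq_ideal (I : set A) :
    I 0 -> (forall a x y, I x -> I y -> I (a * x + y)) ->
  exists2 d, (d %| q)%N & I d%:R /\ forall x, I x -> exists a, x = a * d%:R.
Proof.
move=> I0 IP; pose P d := (0 < d)%N && `[< I d%:R >].
have Pq : exists d, P d.
  by exists q; rewrite /P (ltnW q_gt1) pchar_Zp//; apply/asboolP.
case: (ex_minnP Pq) => d /andP[d_gt0 /asboolP Id] dmin.
have dvd k : I k%:R -> (d %| k)%N.
  move=> Ik; rewrite /dvdn -leqn0 leqNgt; apply/negP => r_gt0.
  suff /dmin : P (k %% d)%N by rewrite leqNgt ltn_mod d_gt0.
  rewrite /P r_gt0; apply/asboolP.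
  have -> : (k %% d)%:R = - (k %/ d)%:R * d%:R + k%:R :> A.
    by rewrite {3}(divn_eq k d) natrD natrM mulNr addKr.
  exact: IP.
exists d; first by apply: dvd; rewrite pchar_Zp.
split=> // x; rewrite -[x]natr_Zp => /dvd /dvdnP[a ->]; exists a%:R.
by rewrite natrM.
Qed.

(** Self-injectivity of Z/q in the form of Baer's criterion, the homomorphism being given by its
    graph. Its domain is the ideal generated by some [d] with [q = e * d]; the image [b] of [d] is
    killed by [e], hence divisible by [d], and [c] is the quotient. *)
Lemma Zq_baer (G : set (A^o * A^o)) :
    submod G -> (forall y, G (0, y) -> y = 0) ->
  exists c : A, forall x y, G (x, y) -> y = x * c.
Proof.
move=> sG Gf; pose I (x : A) := exists y, G (x, y).
have I0 : I 0 by exists 0; exact: submod0 sG.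
have IP a x y : I x -> I y -> I (a * x + y).
  by move=> [x' Gx] [y' Gy]; exists (a *: x' + y'); have := submod_pair a sG Gx Gy.
have [d /dvdnP[e q_de] [[b Gb] Id]] := Zq_ideal I0 IP.
have d_gt0 : (0 < d)%N by case: d q_de q_gt1 {Gb Id} => //; rewrite muln0 => ->.
have e_gt0 : (0 < e)%N by case: e q_de q_gt1 => //; rewrite mul0n => ->.
have eb : e%:R * b = 0.
  apply: Gf; have := submod_pair e%:R sG Gb (submod0 sG).
  by rewrite !addr0 /GRing.scale/= -natrM -q_de pchar_Zp.
have [c bE] : exists c : A, b = d%:R * c.
  move: eb; rewrite -[b]natr_Zp -natrM => /eqP.
  rewrite Zq_nat_eq0 [X in (X %| _)%N]q_de dvdn_pmul2l// => /dvdnP[c ->].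
  by exists c%:R; rewrite -natrM mulnC.
exists c => x y Gxy; have [a xE] := Id x (ex_intro _ y Gxy).
apply/eqP; rewrite -subr_eq0 xE; apply/eqP/Gf.
have := submod_pair (- a) sG Gb Gxy; congr (G (_, _)).
  by rewrite /GRing.scale/= xE mulNr addNr.
by rewrite /GRing.scale/= bE mulNr mulrA addrC.
Qed.

End Zq.

(** * Finitely supported vectors, transvections and finite submodules *)

Section FiniteSupport.
Variable A : comNzRingType.
Local Notation fseq := (fseq A).

Definition supp D (v : fseq) := forall j, (D <= j)%N -> v j = 0.

Lemma suppW D E v : (D <= E)%N -> supp D v -> supp E v.
Proof. by move=> DE vD j Ej; apply: vD; exact: leq_trans Ej. Qed.

Lemma submod_supp D : submod (supp D).
Proof.
split=> [//|a u v uD vD j Dj]; rewrite fseqDE fseqZE uD// vD// mulr0 addr0//.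
Qed.

Lemma trunc_subproof D (f : nat -> A) :
  eventually_zero (fun j => if (j < D)%N then f j else 0).
Proof. by apply/asboolP; exists D => j Dj; rewrite ltnNge Dj. Qed.

Definition trunc D f : fseq := Fseq (trunc_subproof D f).

Lemma truncE D f j : trunc D f j = if (j < D)%N then f j else 0.
Proof. by []. Qed.

Lemma trunc_id D v : supp D v -> trunc D v = v.
Proof. by move=> vD; apply: fseqP => j; rewrite truncE; case: ltnP => // /vD. Qed.

Lemma supp_trunc D f : supp D (trunc D f).
Proof. by move=> j Dj; rewrite truncE ltnNge Dj. Qed.

Lemma trunc_linear D : linear (fun v : fseq => trunc D v).
Proof.
move=> a u v; apply: fseqP => j; rewrite fseqDE fseqZE !truncE.
by case: ifP; rewrite ?mulr0 ?addr0.
Qed.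

Lemma shift_subproof D (v : fseq) :
  eventually_zero (fun j => if (j < D)%N then 0 else v (j - D)%N).
Proof.
have [N vN] := fseq_bound v; apply/asboolP; exists (N + D)%N => j Nj.
case: ltnP => // Dj; rewrite vN// leq_subRL// addnC//.
Qed.

Definition shift D v : fseq := Fseq (shift_subproof D v).

Lemma shiftE D v j : shift D v j = if (j < D)%N then 0 else v (j - D)%N.
Proof. by []. Qed.

Lemma shift_linear D : linear (shift D).
Proof.
move=> a u v; apply: fseqP => j; rewrite fseqDE fseqZE !shiftE.
by case: ifP; rewrite ?mulr0 ?addr0.
Qed.

Lemma unshift_subproof D (v : fseq) : eventually_zero (fun j => v (D + j)%N).
Proof.
have [N vN] := fseq_bound v; apply/asboolP; exists N => j Nj.
by rewrite vN// (leq_trans Nj)// leq_addl.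
Qed.

Definition unshift D v : fseq := Fseq (unshift_subproof D v).

Lemma unshiftE D v j : unshift D v j = v (D + j)%N.
Proof. by []. Qed.

Lemma unshift_linear D : linear (unshift D).
Proof. by move=> a u v; apply: fseqP. Qed.

Lemma trunc_shift D v : trunc D (shift D v) = 0.
Proof. by apply: fseqP => j; rewrite truncE shiftE; case: (j < D)%N. Qed.

Lemma unshift_supp D v : supp D v -> unshift D v = 0.
Proof. by move=> vD; apply: fseqP => j; rewrite unshiftE vD// leq_addr. Qed.

Lemma unshift_shift D v : unshift D (shift D v) = v.
Proof.
by apply: fseqP => j; rewrite unshiftE shiftE ltnNge leq_addr addKn.
Qed.

Lemma linear_vmul (f : {linear fseq -> fseq}) v :
  vmul v (fun i => f (fbasis A i)) = f v.
Proof.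
have [N [vN ->]] := vmulP v (fun i => f (fbasis A i)).
rewrite -[in RHS](vmul1 v) (vmulE _ vN) linear_sum.
by apply: eq_bigr => i _; rewrite linearZ_LR.
Qed.

Lemma rfGL_of_linear (f f' : {linear fseq -> fseq}) :
  cancel f f' -> cancel f' f -> exists g : rfGL A, forall v, vmul v g = f v.
Proof.
move=> fK f'K; pose M (h : fseq -> fseq) : rfmatrix A := fun i => h (fbasis A i).
have Mf : rfinvertible (M f).
  apply/asboolP; exists (M f'); split; apply/funext => i.
    by rewrite /rfmul linear_vmul /M fK.
  by rewrite /rfmul linear_vmul /M f'K.
by exists (RfGL Mf) => v; exact: linear_vmul.
Qed.

(** As [E] has square zero, [1 - E] is inverse to [1 + E]. *)
Lemma transvection (E : fseq -> fseq) : linear E -> (forall v, E (E v) = 0) ->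
  exists g : rfGL A, forall v, vmul v g = v + E v.
Proof.
move=> EL EE; have ED u v : E (u + v) = E u + E v.
  by have := EL 1 u v; rewrite !scale1r.
have EN v : E (- v) = - E v.
  have E0 : E 0 = 0 by rewrite -[in E 0](EE 0) EE.
  by have := EL (-1) v 0; rewrite !scaleN1r E0 !addr0.
have fL : linear (fun v => v + E v).
  by move=> a u v; rewrite EL scalerDr addrACA.
have f'L : linear (fun v => v - E v).
  by move=> a u v; rewrite EL scalerBr opprD addrACA.
apply: (@rfGL_of_linear (HB.pack (fun v => v + E v) (GRing.isLinear.Build _ _ _ _ _ fL))
  (HB.pack (fun v => v - E v) (GRing.isLinear.Build _ _ _ _ _ f'L))) => v /=.
  by rewrite ED EE addr0 addrK.
by rewrite ED EN EE oppr0 addr0 subrK.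
Qed.

(** Over Z/q finiteness is the same as finite generation; the list allows supports to be bounded and
    elements to be counted. *)
Definition fin_submod (L : set fseq) :=
  submod L /\ exists s : seq fseq, forall v, L v <-> v \in s.

Lemma fin_submod_fg L : fin_submod L -> fg_submodule L.
Proof.
move=> [sL [s sE]]; exists (size s), (fun i => s`_i).
apply/seteqP; split=> [v /sE vs|_ [a _ <-]]; last first.
  by apply: submod_sum => // i _; apply: submodZ => //; apply/sE/mem_nth.
have vn : (index v s < size s)%N by rewrite index_mem.
exists (fun i => (i == Ordinal vn)%:R) => //.
rewrite (bigD1 (Ordinal vn))//= eqxx scale1r nth_index// big1 ?addr0//.
by move=> i /negPf->; rewrite scale0r.
Qed.

Lemma fin_submod_bound L : fin_submod L -> exists D, forall v, L v -> supp D v.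
Proof.
move=> [_ [s sE]]; suff [D sD] : exists D, forall v, v \in s -> supp D v.
  by exists D => v /sE /sD.
elim: s {sE} => [|u s [D sD]]; first by exists 0%N.
have [N uN] := fseq_bound u; exists (maxn D N) => v; rewrite inE => /orP[/eqP->|].
  by apply: suppW uN; exact: leq_maxr.
by move/sD; apply: suppW; exact: leq_maxl.
Qed.

Lemma fin_submod_sub L M : submod M -> M `<=` L -> fin_submod L -> fin_submod M.
Proof.
move=> sM ML [_ [s sE]]; split=> //; exists [seq v <- s | `[< M v >]] => v.
rewrite mem_filter; split=> [Mv|/andP[/asboolP]//].
by apply/andP; split; [exact/asboolP | exact/sE/ML].
Qed.

Lemma fin_submod_vmul L (g : rfGL A) :
  fin_submod L -> fin_submod [set vmul v g | v in L].
Proof.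
move=> [[L0 LP] [s sE]]; split.
  split.
    by exists 0 => //; rewrite (@vmulE _ 0)// big_ord0.
  by move=> a _ _ [u Lu <-] [v Lv <-]; exists (a *: u + v);
    [exact: LP | exact: vmul_is_linear].
exists [seq vmul v g | v <- s] => v; split=> [[u Lu <-]|/mapP[u us ->]].
  by apply/map_f/sE.
by exists u => //; apply/sE.
Qed.

End FiniteSupport.

Lemma fin_submod_supp q D : fin_submod (@supp 'Z_q D).
Proof.
split; first exact: submod_supp.
exists [seq trunc D (fun j => if insub j is Some i then f i else 0) |
         f : {ffun 'I_D -> 'Z_q} <- enum {: {ffun 'I_D -> 'Z_q}}] => v.
split=> [vD|/mapP[f _ ->]]; last exact: supp_trunc.
apply/mapP; exists [ffun i : 'I_D => v i]; rewrite ?mem_enum//.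
apply: fseqP => j; rewrite truncE; case: ltnP => [jD|/vD//].
by rewrite insubT ffunE.
Qed.

(** * Extension of partial maps by self-injectivity, and general position *)

Section Extension.
Variables (q : nat) (q_gt1 : (1 < q)%N).
Local Notation A := 'Z_q.
Local Notation fseq := (fseq A).

(* Induction on N: the values of the N-th coordinate form an ideal, on which
   the defect of the functional found for the first N coordinates is
   extended by self-injectivity of Z/q. *)
Lemma extend_functional (G : set (fseq * A^o)) :
    submod G -> (forall b, G (0, b) -> b = 0) ->
  forall N, exists c : nat -> A, forall l b, G (l, b) -> supp N l ->
    b = \sum_(i < N) l i * c i.
Proof.
move=> sG Gf; elim=> [|N [c cE]].
  exists (fun=> 0) => l b Glb l0; rewrite big_ord0; apply: Gf.
  by rewrite (_ : 0 = l)//; apply: fseqP => j; rewrite l0.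
pose defect (l : fseq) (b : A^o) : A^o := b - \sum_(i < N) l i * c i.
pose P : set (A^o * A^o) :=
  [set xy | exists l b, [/\ G (l, b), supp N.+1 l & xy = (l N, defect l b)]].
have sP : submod P.
  split=> [|a _ _ [l [b [Glb lN ->]]] [l' [b' [Glb' lN' ->]]]].
    exists 0, 0; split; [exact: (submod0 sG) | by [] | congr (_, _)].
    by rewrite /defect big1 ?subr0// => i _; rewrite mul0r.
  exists (a *: l + l'), (a *: b + b'); split.
  - by have := submod_pair a sG Glb Glb'.
  - by apply (submod_supp A N.+1).2.
  - congr (_, _); rewrite /defect /= [X in X + _](_ : _ = a *: (b - \sum_(i < N) l i * c i))//.
    rewrite scalerBr addrACA -opprD; congr (_ - _).
    rewrite /GRing.scale/= mulr_sumr -big_split; apply: eq_bigr => i _ /=.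
    by rewrite mulrDl mulrA.
(* A vector with zero [N]-th coordinate is supported on the first [N] ones, where [c] is already
   exact; so the defect is a function of the [N]-th coordinate. *)
have Pf y : P (0, y) -> y = 0.
  move=> [l [b [Glb lN [l0 ->]]]]; rewrite /defect; apply/eqP.
  rewrite subr_eq0; apply/eqP/cE => // j; rewrite leq_eqVlt => /orP[/eqP<-//|].
  exact: lN.
have [x xE] := Zq_baer q_gt1 sP Pf.
exists (fun i => if i == N then x else c i) => l b Glb lN.
rewrite big_ord_recr/= eqxx -(xE (l N) (defect l b)); last by exists l, b.
rewrite addrC /defect -[LHS](subrK (\sum_(i < N) l i * c i)); congr (_ + _).
by apply: eq_bigr => i _; rewrite ltn_eqF.
Qed.

(** Each coordinate of the image is a functional of the argument and extends separately; these
    functionals are the columns of [F]. *)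
Lemma extend_linear (G : set (fseq * fseq)) D :
    submod G -> (forall m, G (0, m) -> m = 0) ->
    (forall l m, G (l, m) -> supp D l /\ supp D m) ->
  exists F : rfmatrix A, forall l m, G (l, m) -> vmul l F = m.
Proof.
move=> sG Gf GD.
have /choice[c cE] j : exists c : nat -> A, forall l m, G (l, m) ->
    m j = \sum_(i < D) l i * c i.
  pose P : set (fseq * A^o) := [set lb | exists2 m, G (lb.1, m) & lb.2 = m j].
  have [||c cE] := @extend_functional P _ _ D.
  - split=> [|a [l b] [l' b'] [/= m Gm ->] [/= m' Gm' ->]].
      by exists 0 => //; exact: (submod0 sG).
    by exists (a *: m + m') => //; have := submod_pair a sG Gm Gm'.
  - by move=> b [/= m /Gf-> ->].
  exists c => l m Glm; apply: cE; last by have [] := GD _ _ Glm.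
  by exists m.
(* Truncation makes the rows finitely supported and loses nothing, since the images live on the
   first [D] coordinates. *)
exists (fun i => trunc D (c^~ i)) => l m Glm; have [lD mD] := GD _ _ Glm.
rewrite (vmulE _ lD); apply: fseqP => j; rewrite fseq_sumE.
case: (ltnP j D) => [jD|Dj].
  by rewrite (cE _ _ _ Glm); apply: eq_bigr => i _; rewrite fseqZE truncE jD.
by rewrite mD// big1// => i _; rewrite fseqZE truncE ltnNge Dj mulr0.
Qed.

(* With A^D + A^D the sum of the first two blocks of D coordinates, [g] is
   (l, 0) -> (l, m) -> (m, m) -> (m, 0); each arrow is a transvection. *)
Lemma partial_iso_extends (G : set (fseq * fseq)) D :
    submod G -> (forall m, G (0, m) -> m = 0) -> (forall l, G (l, 0) -> l = 0) ->
    (forall l m, G (l, m) -> supp D l /\ supp D m) ->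
  exists g : rfGL A, forall l m, G (l, m) -> vmul l g = m.
Proof.
move=> sG Gf Gi GD; have [F FE] := extend_linear sG Gf GD.
have [||H HE] := @extend_linear [set ml | G (ml.2, ml.1)] D _ Gi.
- split; first exact: (submod0 sG).
  by move=> a [l m] [l' m'] /= Glm Glm'; have := submod_pair a sG Glm Glm'.
- by move=> m l /GD[].
have vmulB u v g : vmul (u - v) g = vmul u g - vmul v g.
  by have := vmul_is_linear g (-1) v u; rewrite !scaleN1r ![- _ + _]addrC.
(* One map for each arrow: [E1] writes [m] into the second block, [E2] adds [m - l] to the first,
   [E3] clears the second. *)
pose E1 (v : fseq) := shift D (vmul (trunc D v) F).
pose E2 (v : fseq) := trunc D (unshift D v - vmul (unshift D v) H).
pose E3 (v : fseq) := - shift D (trunc D v).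
have E1L : linear E1.
  by move=> a u v; rewrite /E1 trunc_linear vmul_is_linear shift_linear.
have E2L : linear E2.
  move=> a u v; rewrite /E2 unshift_linear vmul_is_linear -trunc_linear.
  by rewrite scalerBr addrACA -opprD.
have E3L : linear E3.
  by move=> a u v; rewrite /E3 trunc_linear shift_linear opprD scalerN.
have vmul0 g : vmul (0 : fseq) g = 0 by rewrite (@vmulE _ 0)// big_ord0.
have shift0 : shift D (0 : fseq) = 0.
  by apply: fseqP => j; rewrite shiftE if_same.
have trunc0 : trunc D (0 : fseq) = 0.
  by apply: fseqP => j; rewrite truncE if_same.
have [g1 g1E] : exists g : rfGL A, forall v, vmul v g = v + E1 v.
  by apply: transvection => // v; rewrite /E1 trunc_shift vmul0 shift0.
have [g2 g2E] : exists g : rfGL A, forall v, vmul v g = v + E2 v.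
  apply: transvection => // v.
  by rewrite {1}/E2 unshift_supp ?vmul0 ?subr0 ?trunc0//; exact: supp_trunc.
have [g3 g3E] : exists g : rfGL A, forall v, vmul v g = v + E3 v.
  apply: transvection => // v.
  have E3t : trunc D (E3 v) = 0.
    apply: fseqP => j; rewrite truncE -[E3 v j]/(- (shift D (trunc D v) j)).
    by rewrite shiftE; case: (j < D)%N; rewrite // oppr0.
  by rewrite {1}/E3 E3t shift0 oppr0.
exists (g1 * g2 * g3)%g => l m Glm; have [lD mD] := GD _ _ Glm.
rewrite !vmulgM g1E /E1 trunc_id// (FE _ _ Glm) g2E /E2.
have -> : unshift D (l + shift D m) = m.
  have := unshift_linear D 1 l (shift D m); rewrite !scale1r => ->.
  by rewrite unshift_shift unshift_supp// add0r.
rewrite (HE _ _ Glm) trunc_id; last first.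
  by move=> j Dj; rewrite fseqDE [(- l) j]/(- (l j)) lD// mD// subr0.
rewrite [l + _]addrC -addrA [l + _]addrCA subrr addr0 addrC g3E /E3.
have -> : trunc D (m + shift D m) = m.
  apply: fseqP => j; rewrite truncE fseqDE shiftE.
  by case: ltnP => [|/mD//]; rewrite addr0.
by rewrite addrK.
Qed.

(** Let [d] generate the ideal of all [a] with [a *: m] in [N], and [q = e * d]. Then [a *: m + v]
    with [v] in [N] can be sent to [a * e]: this is well defined because [d * e = 0], and [e] is
    nonzero because [d = 1] would put [m] into [N]. This functional is then extended. *)
Lemma annihilator (N : set fseq) D m :
    submod N -> supp D m -> (forall v, N v -> supp D v) -> ~ N m ->
  exists c : nat -> A, (forall v, N v -> \sum_(i < D) v i * c i = 0) /\
    \sum_(i < D) m i * c i <> 0.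
Proof.
move=> sN mD ND Nm; pose I (a : A) := N (a *: m).
have [d /dvdnP[e q_de] [Id dI]] : exists2 d, (d %| q)%N &
    I d%:R /\ forall x, I x -> exists a, x = a * d%:R.
  apply: Zq_ideal => // [|a x y Ix Iy]; first by rewrite /I scale0r; exact: submod0.
  by rewrite /I scalerDl -scalerA; apply sN.2.
have e0 : e%:R <> 0 :> A.
  move/eqP; rewrite Zq_nat_eq0// [X in (X %| _)%N]q_de => /dvdnP[k].
  case: e q_de => [q0|e q_de]; first by move: q_gt1; rewrite q0.
  rewrite mulnCA -[LHS]muln1 => /eqP; rewrite eqn_pmul2l// eq_sym muln_eq1.
  by move=> /andP[_ /eqP d1]; apply: Nm; move: Id; rewrite /I d1 scale1r.
pose G : set (fseq * A^o) :=
  [set lb | exists a v, N v /\ lb = (a *: m + v, a * e%:R)].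
have [||c cE] := @extend_functional G _ _ D.
- split=> [|a _ _ [b [v [Nv ->]]] [b' [v' [Nv' ->]]]].
    by exists 0, 0; rewrite scale0r mul0r addr0; split=> //; exact: submod0.
  exists (a * b + b'), (a *: v + v'); split; first by apply sN.2.
  congr (_, _); last by rewrite mulrDl -mulrA.
  by rewrite /= scalerDl scalerDr scalerA addrACA.
- move=> b [a [v [Nv E]]]; have /= /esym av := congr1 fst E.
  rewrite [b](congr1 snd E) /=.
  have : I a.
    rewrite /I (_ : a *: m = - 1 *: v); first exact: submodZ.
    by rewrite scaleN1r; apply/eqP; rewrite -addr_eq0 av.
  move=> /dI[x ->]; rewrite -mulrA -natrM mulnC -q_de pchar_Zp// mulr0//.
exists c; split=> [v Nv|].
  rewrite -(cE v 0)//; last exact: ND.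
  by exists 0, v; rewrite scale0r add0r mul0r.
rewrite -(cE m e%:R)//; exists 1, 0.
by rewrite scale1r mul1r addr0; split=> //; exact: submod0.
Qed.

(* [k] is 1 + E where E v lists, beyond the first D coordinates, the values
   at v of all functionals on A^D that vanish on N. *)
Lemma general_position (N M : set fseq) D :
    submod N -> N `<=` M -> (forall v, M v -> supp D v) ->
  exists2 k : rfGL A, ptstab N k &
    forall m, M m -> supp D (vmul m k) -> N m.
Proof.
move=> sN NM MD; pose dot (c : {ffun 'I_D -> A}) (v : fseq) := \sum_(i < D) v i * c i.
pose P (c : {ffun 'I_D -> A}) := `[< forall v, N v -> dot c v = 0 >].
(* [pickle] gives each functional a coordinate of its own; as [dot] reads only the first [D]
   coordinates, [E] has square zero. *)
pose E (v : fseq) : fseq := \sum_(c | P c) dot c v *: fbasis A (D + pickle c)%N.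
have EL : linear E.
  move=> a u v; rewrite /E scaler_sumr -big_split; apply: eq_bigr => c _ /=.
  rewrite scalerA -scalerDl; congr (_ *: _).
  rewrite /dot mulr_sumr -big_split; apply: eq_bigr => i _ /=.
  by rewrite mulrDl mulrA.
have evE (v : fseq) j : E v j = \sum_(c | P c) dot c v * ((D + pickle c)%N == j)%:R.
  by rewrite /E; elim/big_ind2: _ => // u a w b <- <-.
have E_lt v j : (j < D)%N -> E v j = 0.
  move=> jD; rewrite evE big1// => c _; rewrite gtn_eqF ?mulr0//.
  by rewrite (leq_trans jD)// leq_addr.
have E_ge v c : P c -> E v (D + pickle c)%N = dot c v.
  move=> Pc; rewrite evE (bigD1 c)//= eqxx mulr1 big1 ?addr0// => c' /andP[_ c'c].
  by rewrite eqn_add2l (inj_eq (pcan_inj pickleK)) (negPf c'c) mulr0.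
have [|k kE] := transvection EL.
  move=> v; rewrite {1}/E big1// => c _; rewrite /dot big1 ?scale0r// => i _.
  by rewrite E_lt// mul0r.
exists k => [v Nv|m Mm mD].
  rewrite kE /E big1 ?addr0// => c /asboolP/(_ _ Nv) ->.
  by rewrite scale0r.
(* Otherwise a functional vanishing on [N] but not at [m] shows up in a coordinate of [vmul m k]
   beyond the first [D]. *)
apply: contrapT => Nm.
have [c [cN]] := annihilator sN (MD _ Mm) (fun v Nv => MD _ (NM _ Nv)) Nm.
pose c' := [ffun i : 'I_D => c i].
have dotE v : dot c' v = \sum_(i < D) v i * c i.
  by apply: eq_bigr => i _; rewrite ffunE.
have Pc' : P c' by apply/asboolP => v /cN; rewrite dotE.
rewrite -dotE; apply.
have := mD (D + pickle c')%N (leq_addr _ _); rewrite kE fseqDE E_ge//.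
by rewrite MD ?add0r// leq_addr.
Qed.

(** On [L + M] one sends [l + m] to [vmul l g + vmul m k]. This is well defined because [g] and [k]
    both fix the intersection, and injective because by the last hypothesis the two images meet only
    in the image of the intersection. [partial_iso_extends] applies. *)
Lemma amalgam_extends (L M : set fseq) (g k : rfGL A) :
    fin_submod L -> fin_submod M ->
    ptstab (L `&` M) g -> ptstab (L `&` M) k ->
    (forall l m, L l -> M m -> vmul l g = vmul m k -> (L `&` M) l) ->
  exists h : rfGL A, (forall l, L l -> vmul l h = vmul l g) /\
    forall m, M m -> vmul m h = vmul m k.
Proof.
move=> fL fM gN kN LM.
have [[sL _] [sM _]] := (fL, fM).
have [D1 LD] := fin_submod_bound fL; have [D2 MD] := fin_submod_bound fM.
have [D3 LgD] := fin_submod_bound (fin_submod_vmul g fL).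
have [D4 MkD] := fin_submod_bound (fin_submod_vmul k fM).
pose D := (D1 + D2 + D3 + D4)%N.
pose G : set (fseq * fseq) :=
  [set xy | exists l m, [/\ L l, M m & xy = (l + m, vmul l g + vmul m k)]].
have vmulN v h : vmul (- v) h = - vmul v h.
  have := vmul_is_linear h (-1) v 0.
  by rewrite !scaleN1r addr0 [vmul 0 h](@vmulE _ 0)// big_ord0 addr0.
have vmul_inj (h : rfGL A) u v : vmul u h = vmul v h -> u = v.
  by move=> uv; rewrite -[u](vmulgK h) uv vmulgK.
have MN m : M m -> M (- m) by rewrite -scaleN1r; exact: submodZ.
have [|m|x|x y|h hE] := @partial_iso_extends G D.
- split=> [|a _ _ [l [m [Ll Mm ->]]] [l' [m' [Ll' Mm' ->]]]].
    exists 0, 0; split; [exact: submod0|exact: submod0|].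
    by rewrite ![vmul 0 _](@vmulE _ 0)// !big_ord0 !addr0.
  exists (a *: l + l'), (a *: m + m'); split; [by apply sL.2|by apply sM.2|].
  by congr (_, _); rewrite ?vmul_is_linear [RHS]addrACA -scalerDr.
- move=> [l [m' [Ll Mm' E]]]; have /= /esym/eqP := congr1 fst E.
  rewrite [m](congr1 snd E) /= addr_eq0 => /eqP lE.
  have Ml : M l by rewrite lE; exact: MN.
  have -> : m' = - l by rewrite lE opprK.
  by rewrite vmulN gN// kN// subrr.
- move=> [l [m [Ll Mm E]]]; have /= /esym/eqP := congr1 snd E.
  rewrite [x](congr1 fst E) /= addr_eq0 -vmulN => /eqP lm.
  have lN := LM _ _ Ll (MN _ Mm) lm.
  move: lm; rewrite (gN _ lN) -{1}(kN _ lN) => /vmul_inj ->; exact: addNr.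
- move=> [l [m [Ll Mm E]]].
  rewrite [x](congr1 fst E) [y](congr1 snd E) /=; split.
    apply: (submodD (submod_supp A _)).
      by apply: suppW (LD _ Ll); rewrite /D -!addnA leq_addr.
    by apply: suppW (MD _ Mm); rewrite /D -!addnA addnCA leq_addr.
  apply: (submodD (submod_supp A _)).
    have : supp D3 (vmul l g) by apply: LgD; exists l.
    by apply: suppW; rewrite /D addnAC leq_addl.
  have : supp D4 (vmul m k) by apply: MkD; exists m.
  by apply: suppW; rewrite /D leq_addl.
exists h; split=> [l Ll|m Mm].
  apply: hE; exists l, 0; split=> //; first exact: submod0.
  by rewrite [vmul 0 _](@vmulE _ 0)// big_ord0 !addr0.
apply: hE; exists 0, m; split=> //; first exact: submod0.
by rewrite [vmul 0 _](@vmulE _ 0)// big_ord0 !add0r.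
Qed.

End Extension.

(** * Hilbert spaces *)

Section HilbertSpace.
Variables (K : realType) (H : hilbertType K).
Local Notation C := K[i].
Implicit Types (u v w x y : H).

(** Norm and inner product have values in [K[i]]; their real parts live in the ordered field [K]. On
    a set stable under complex scalars, orthogonality for [rip] is the same as for [inner]. *)
Definition nrm v : K := complex.Re `|v|.
Definition rip u v : K := complex.Re (inner u v).

Lemma normE v : `|v| = (nrm v)%:C%C.
Proof. by rewrite /nrm RRe_real// ger0_real. Qed.

Lemma ReD (a b : C) : complex.Re (a + b) = complex.Re a + complex.Re b.
Proof. by case: a b => a1 a2 [b1 b2]. Qed.

Lemma ReN (a : C) : complex.Re (- a) = - complex.Re a.
Proof. by case: a. Qed.

Lemma nrm_ge0 v : 0 <= nrm v.
Proof. by rewrite -ler0c -normE. Qed.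

Lemma nrm_eq0 v : nrm v = 0 -> v = 0.
Proof. by move=> v0; apply: normr0_eq0; rewrite normE v0. Qed.

Lemma nrm0 : nrm 0 = 0.
Proof. by rewrite /nrm normr0. Qed.

Lemma nrmN v : nrm (- v) = nrm v.
Proof. by rewrite /nrm normrN. Qed.

Lemma nrmB u v : nrm (u - v) = nrm (v - u).
Proof. by rewrite -nrmN opprB. Qed.

Lemma nrmD u v : nrm (u + v) <= nrm u + nrm v.
Proof. by rewrite -lecR rmorphD/= -!normE ler_normD. Qed.

Lemma nrm_tri w u v : nrm (u - v) <= nrm (u - w) + nrm (w - v).
Proof. by rewrite -[u - v](subrKA w) nrmD. Qed.

Lemma inner_nrm v : inner v v = (nrm v ^+ 2)%:C%C.
Proof. by rewrite -sqr_norm_inner normE rmorphXn. Qed.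

Lemma ripvv v : rip v v = nrm v ^+ 2.
Proof. by rewrite /rip inner_nrm. Qed.

Lemma ripC u v : rip u v = rip v u.
Proof.
have uv : inner u v = Num.conj (inner v u).
  by rewrite [LHS](@hermC _ false (@Num.conj C)) expr0 mul1r.
by rewrite /rip uv; case: (inner v u).
Qed.

Lemma ripDr u v w : rip u (v + w) = rip u v + rip u w.
Proof. by rewrite /rip linearDr ReD. Qed.

Lemma ripDl u v w : rip (v + w) u = rip v u + rip w u.
Proof. by rewrite ripC ripDr ![rip u _]ripC. Qed.

Lemma ripNr u v : rip u (- v) = - rip u v.
Proof. by rewrite /rip linearNr ReN. Qed.

Lemma ripBr u v w : rip u (v - w) = rip u v - rip u w.
Proof. by rewrite ripDr ripNr. Qed.

Lemma ripBl u v w : rip (v - w) u = rip v u - rip w u.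
Proof. by rewrite ripC ripBr ![rip u _]ripC. Qed.

Lemma rip0r u : rip u 0 = 0.
Proof. by rewrite -(subrr 0) ripBr subrr. Qed.

Lemma rip0l u : rip 0 u = 0. Proof. by rewrite ripC rip0r. Qed.

Lemma rip_sumr u I (r : seq I) (P : pred I) (F : I -> H) :
  rip u (\sum_(i <- r | P i) F i) = \sum_(i <- r | P i) rip u (F i).
Proof.
elim/big_rec2: _ => [|i y z _ <-]; [exact: rip0r | exact: ripDr].
Qed.

(** This recovers complex linearity of the orthogonal projection, which is characterized by real
    inner products. *)
Lemma ripZ (a : C) u v : rip (a *: u) v = rip u ((a^*)%C *: v).
Proof.
rewrite /rip linearZl_LR [inner u (_ *: _)]linearZr_LR /=.
by rewrite [Num.conj _]conjcK.
Qed.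

Lemma ripZr (r : K) u v : rip (r%:C%C *: u) v = r * rip u v.
Proof.
by rewrite /rip linearZl_LR /=; case: (inner u v) => a b /=; rewrite mul0r subr0.
Qed.

Lemma nrmD_sqr u v : nrm (u + v) ^+ 2 = nrm u ^+ 2 + nrm v ^+ 2 + 2 * rip u v.
Proof. by rewrite -!ripvv ripDl !ripDr [rip v u]ripC; ring. Qed.

Lemma nrmB_sqr u v : nrm (u - v) ^+ 2 = nrm u ^+ 2 + nrm v ^+ 2 - 2 * rip u v.
Proof. by rewrite nrmD_sqr nrmN ripNr; ring. Qed.

Lemma nrmZ (r : K) v : nrm (r%:C%C *: v) = `|r| * nrm v.
Proof.
apply/eqP; rewrite -(eqrXn2 (n := 2))// ?nrm_ge0 ?mulr_ge0 ?nrm_ge0//.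
by rewrite -ripvv ripZr ripC ripZr ripvv exprMn real_normK ?num_real// mulrA expr2.
Qed.

(** Cauchy-Schwarz: expand the squared norm of [u] minus its projection to the real line of [v]. *)
Lemma rip_le u v : `|rip u v| <= nrm u * nrm v.
Proof.
have [->|v0] := eqVneq v 0; first by rewrite rip0r nrm0 mulr0 normr0.
have nv : 0 < nrm v.
  by rewrite lt_def nrm_ge0 andbT; apply: contra_neq v0; exact: nrm_eq0.
rewrite -(@ler_pXn2r _ 2)// ?nnegrE ?mulr_ge0 ?nrm_ge0 ?real_normK ?num_real//.
have : 0 <= nrm (u - (rip u v / nrm v ^+ 2)%:C%C *: v) ^+ 2 by rewrite sqr_ge0.
rewrite nrmB_sqr nrmZ [rip u (_ *: _)]ripC ripZr [rip v u]ripC.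
rewrite exprMn real_normK ?num_real//.
have -> : nrm u ^+ 2 + (rip u v / nrm v ^+ 2) ^+ 2 * nrm v ^+ 2 -
    2 * (rip u v / nrm v ^+ 2 * rip u v) =
    (nrm u ^+ 2 * nrm v ^+ 2 - rip u v ^+ 2) / nrm v ^+ 2.
  by field; rewrite gt_eqF.
by rewrite pmulr_lge0 ?invr_gt0 ?exprn_gt0// subr_ge0 exprMn.
Qed.

(** The radii of balls are positive elements of [K[i]], and such elements are real. *)
Lemma nbhs_nrm v (A : set H) :
  nbhs v A <-> exists2 e : K, 0 < e & forall u, nrm (u - v) < e -> A u.
Proof.
rewrite -nbhs_ballE; split=> [[e /= e0 eA]|[e e0 eA]].
  have eE : e = (complex.Re e)%:C%C by rewrite RRe_real// gtr0_real.
  exists (complex.Re e); first by rewrite -ltcR -eE.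
  move=> u uv; apply: eA; rewrite -ball_normE /= normE nrmB eE ltcR//.
exists e%:C%C; first by rewrite /= ltcR.
move=> u; rewrite -ball_normE /= normE ltcR nrmB; exact: eA.
Qed.

Lemma closed_nrm (A : set H) v : closed A ->
  (forall e : K, 0 < e -> exists2 u, A u & nrm (u - v) < e) -> A v.
Proof.
move=> cA vA; apply: cA => B /nbhs_nrm[e e0 eB].
by have [u Au uv] := vA _ e0; exists u; split=> //; exact: eB.
Qed.

Lemma nrm_closed (A : set H) :
  (forall v, (forall e : K, 0 < e -> exists2 u, A u & nrm (u - v) < e) -> A v) ->
  closed A.
Proof.
move=> AP v vA; apply: AP => e e0.
have /vA[u [Au uv]] : nbhs v [set u | nrm (u - v) < e].
  by apply/nbhs_nrm; exists e.
by exists u.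
Qed.

(* The Cauchy criterion for the filter with basis [S e], e > 0. *)
Lemma cauchy_basis (S : K -> set H) :
    (forall e, 0 < e -> exists v, S e v) ->
    (forall d e, d <= e -> S d `<=` S e) ->
    (forall d, 0 < d -> exists2 e, 0 < e &
      forall u v, S e u -> S e v -> nrm (u - v) < d) ->
  exists l, forall d, 0 < d -> exists2 e, 0 < e & forall v, S e v -> nrm (v - l) < d.
Proof.
move=> S0 SS Sd; pose F := filter_from [set e : K | 0 < e] S.
have FF : ProperFilter F.
  apply: filter_from_proper => [|e /S0//].
  apply: filter_from_filter => [|d e /= d0 e0]; first by exists 1 => /=.
  exists (Num.min d e) => /=; first by rewrite lt_min d0.
  by move=> v Sv; split; apply: SS Sv; rewrite ge_min lexx ?orbT.
have cF : cauchy F.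
  apply: cauchy_exP => e e0.
  have eE : e = (complex.Re e)%:C%C by rewrite RRe_real// gtr0_real.
  have : 0 < complex.Re e by rewrite -ltcR -eE.
  move=> /Sd[d d0 Sde]; have [v Sv] := S0 _ d0; exists v, d => //= u Su.
  by rewrite -ball_normE/= normE eE ltcR; exact: Sde.
have /cvg_ex[l Fl] := @cauchy_cvg _ F FF cF; exists l => d d0.
have : nbhs l [set v | nrm (v - l) < d] by apply/nbhs_nrm; exists d.
by move=> /Fl[e e0 Se]; exists e.
Qed.

Definition mid u v := (2^-1 : K)%:C%C *: (u + v).

(** The parallelogram law, solved for the difference. *)
Lemma mid_sqr u v :
  nrm (u - v) ^+ 2 = 2 * (nrm u ^+ 2 + nrm v ^+ 2) - 4 * nrm (mid u v) ^+ 2.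
Proof.
rewrite /mid nrmZ exprMn real_normK ?num_real// nrmB_sqr nrmD_sqr.
by field.
Qed.

Lemma midvv v : mid v v = v.
Proof.
rewrite /mid (_ : v + v = (2 : C) *: v); last by rewrite scaler_nat mulr2n.
rewrite scalerA (_ : _ * 2 = 1) ?scale1r//.
by rewrite fmorphV rmorph_nat mulVf// pnatr_eq0.
Qed.

(** For a closed set this is convexity, in the form to which the parallelogram law applies. *)
Definition midclosed (A : set H) :=
  closed A /\ forall u v, A u -> A v -> A (mid u v).

(** A midpoint of two points of [A] has norm at least the infimum [r], so by the parallelogram law
    points of nearly minimal norm are close together. They form a Cauchy filter, and its limit is
    the minimum. *)
Lemma min_norm (A : set H) : midclosed A -> A !=set0 ->
  exists a, [/\ A a, forall v, A v -> nrm a <= nrm v &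
    forall v, A v -> nrm v <= nrm a -> v = a].
Proof.
move=> [cA mA] [v0 Av0]; pose D : set K := [set nrm v | v in A].
have D0 : D !=set0 by exists (nrm v0), v0.
have Dl : has_lbound D by exists 0 => _ [v _ <-]; exact: nrm_ge0.
pose r := inf D.
have rD v : A v -> r <= nrm v by move=> Av; apply: ge_inf => //; exists v.
have r0 : 0 <= r by apply: lb_le_inf => // _ [v _ <-]; exact: nrm_ge0.
have close e u v : 0 <= e -> A u -> A v -> nrm u <= r + e -> nrm v <= r + e ->
    nrm (u - v) ^+ 2 <= 4 * e * (2 * r + e).
  move=> e0 Au Av ur vr; rewrite mid_sqr.
  have := rD _ (mA _ _ Au Av); have := nrm_ge0 u; have := nrm_ge0 v.
  move: (nrm _) (nrm u) (nrm v) ur vr => m a b; nra.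
have [||d d0|a Sa] := @cauchy_basis (fun e => [set v | A v /\ nrm v <= r + e]).
- move=> e e0; have /inf_adherent : has_inf D by [].
  by move=> /(_ e e0)[_ [v Av <-] /ltW]; exists v.
- by move=> d e de v [Av vd]; split=> //; apply: le_trans vd _; rewrite lerD2l.
(* With this choice [4 * e * (2 * r + e)] is at most [d ^+ 2 / 2]. *)
- pose e := Num.min 1 (d ^+ 2 / (8 * (2 * r + 1))).
  have r8 : 0 < 8 * (2 * r + 1) by lra.
  have e0 : 0 < e by rewrite lt_min ltr01 divr_gt0// exprn_gt0.
  exists e => // u v [Au ur] [Av vr].
  have ed : e * (8 * (2 * r + 1)) <= d ^+ 2.
    by rewrite -ler_pdivlMr// ge_min lexx orbT.
  have e1 : e <= 1 by rewrite ge_min lexx.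
  have := close e u v (ltW e0) Au Av ur vr.
  rewrite -(@ltr_pXn2r _ 2)// ?nnegrE ?nrm_ge0 ?(ltW d0)// => /le_lt_trans; apply.
  nra.
have Aa : A a.
  apply: closed_nrm => // d /Sa[e e0 Se].
  have /inf_adherent : has_inf D by [].
  move=> /(_ e e0)[_ [v Av <-] /ltW vr]; exists v => //.
  by apply: Se; split.
have ar : nrm a <= r.
  apply/ler_addgt0Pl => d d0.
  have d2 : 0 < d / 2 by lra.
  have [e e0 Se] := Sa _ d2.
  have /inf_adherent : has_inf D by [].
  have de0 : 0 < Num.min e (d / 2) by rewrite lt_min e0.
  move=> /(_ _ de0)[_ [v Av <-] /ltW vr].
  have vd : nrm v <= r + d / 2.
    by apply: le_trans vr _; rewrite lerD2l ge_min lexx orbT.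
  have va : nrm (v - a) < d / 2.
    by apply: Se; split=> //; apply: le_trans vr _; rewrite lerD2l ge_min lexx.
  have := nrmD (a - v) v; rewrite subrK nrmB.
  by move: (nrm a) (nrm v) (nrm (v - a)) vd va => ? ? ?; lra.
exists a; split=> // [v Av|v Av va]; first exact: le_trans (rD _ Av).
have := close 0 v a (lexx _) Av Aa; rewrite addr0 mulr0 mul0r.
move=> /(_ (le_trans va ar) ar).
rewrite real_exprn_even_le0 ?num_real//= => /eqP/nrm_eq0 /eqP.
by rewrite subr_eq0 => /eqP.
Qed.

End HilbertSpace.

(** * Closed convex hulls, orthogonal projection, and closed subspaces as Hilbert spaces *)

Section Subspace.
Variables (K : realType) (H : hilbertType K).
Local Notation C := K[i].
Implicit Types (u v w x y : H).

(** The closed convex hull as an intersection: to prove a property on it, one shows that the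
    property defines a midpoint-closed set containing [A]. *)
Definition hull (A : set H) : set H :=
  [set v | forall B, midclosed B -> A `<=` B -> B v].

Lemma sub_hull (A : set H) : A `<=` hull A.
Proof. by move=> v Av B _; exact. Qed.

Lemma hull_midclosed (A : set H) : midclosed (hull A).
Proof.
split=> [|u v Au Av B mB AB]; last by apply: mB.2; [exact: Au | exact: Av].
apply: nrm_closed => v vA B mB AB; apply: (closed_nrm mB.1) => e /vA[u Au uv].
by exists u => //; exact: Au.
Qed.

Lemma midclosed_preimage (f : {linear H -> H}) (B : set H) :
  (forall v, nrm (f v) = nrm v) -> midclosed B -> midclosed [set v | B (f v)].
Proof.
move=> fi [cB mB]; split=> [|u v Bu Bv /=]; last first.
  by rewrite /mid linearZ linearD; exact: mB.
apply: nrm_closed => v vB; apply: (closed_nrm cB) => e /vB[u Bu uv].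
by exists (f u) => //; rewrite -linearB fi.
Qed.

(** The isometries in [F] map the hull into itself and preserve the norm, so they fix its unique
    element of minimal norm. *)
Lemma hull_fixed (A : set H) (F : set {linear H -> H}) :
    A !=set0 -> (forall f, F f -> forall v, nrm (f v) = nrm v) ->
    (forall f v, F f -> A v -> A (f v)) ->
  exists2 a, hull A a & forall f, F f -> f a = a.
Proof.
move=> [v0 Av0] Fi FA.
have [|a [Aa amin auniq]] := min_norm (hull_midclosed A).
  by exists v0; exact: sub_hull.
exists a => // f Ff; apply: auniq; last by rewrite Fi.
move=> B mB AB; apply: (Aa [set v | B (f v)]).
  by apply: midclosed_preimage => //; exact: Fi.
by move=> v Av; apply: AB; exact: FA.
Qed.

(** Keeps the hull of an orbit near [v] once the orbit itself is near [v]. *)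
Lemma midclosed_ball v (r : K) : midclosed [set u | nrm (u - v) <= r].
Proof.
split=> [|x y /= xr yr].
  apply: nrm_closed => w wr /=; apply/ler_addgt0Pl => e /wr[u /= ur uw].
  have := nrm_tri u w v; rewrite (nrmB w u) => /le_trans; apply.
  by apply: lerD => //; exact: ltW.
have -> : mid x y - v = mid (x - v) (y - v).
  by rewrite -[in LHS](midvv v) /mid -scalerBr opprD addrACA.
rewrite /mid nrmZ ger0_norm ?invr_ge0// ler_pdivrMl//.
by apply: le_trans (nrmD _ _) _; rewrite mulr2n mulrDl mul1r lerD.
Qed.

Lemma orthogonal_projection (W : set H) v : closed W -> submod W ->
  exists2 w, W w & forall u, W u -> rip (v - w) u = 0.
Proof.
move=> cW sW; have [||a [[w Ww <-] amin _]] := @min_norm _ _ [set v - w | w in W].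
- split=> [|_ _ [x Wx <-] [y Wy <-]].
    apply: nrm_closed => x xP; exists (v - x); last by rewrite subKr.
    apply: closed_nrm => // e /xP[_ [w Ww <-] wx]; exists w => //.
    by rewrite nrmB -[v - x - w]addrAC.
  exists (mid x y); first by apply: submodZ => //; exact: submodD.
  by rewrite -[in LHS](midvv v) /mid -scalerBr opprD addrACA.
- by exists (v - 0), 0 => //; exact: submod0.
exists w => // u Wu; set r := rip _ _.
(* Replacing [w] by [w + t u] changes the squared distance to [v] by [- t ^+ 2 * (nrm u ^+ 2 + 2)],
   so minimality forces [t = 0]. The summand 1 keeps the denominator positive when [u = 0]. *)
pose t := r / (nrm u ^+ 2 + 1).
have : nrm (v - w) ^+ 2 <= nrm (v - (w + t%:C%C *: u)) ^+ 2.
  rewrite ler_pXn2r// ?nnegrE ?nrm_ge0//; apply: amin.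
  exists (w + t%:C%C *: u) => //; apply: submodD => //; exact: submodZ.
have n0 : 0 <= nrm u ^+ 2 by exact: sqr_ge0.
have tE : r = t * (nrm u ^+ 2 + 1) by rewrite /t divfK// gt_eqF// ltr_wpDl.
rewrite opprD addrA [X in _ <= X]nrmB_sqr nrmZ exprMn real_normK ?num_real//.
rewrite [rip _ (_ *: _)]ripC ripZr ripC -/r tE.
move: (nrm u ^+ 2) n0 (nrm (v - w) ^+ 2) => n n0 m; clear -n0.
have [-> _|t0] := eqVneq t 0; first by rewrite mul0r.
have : 0 < t ^+ 2 by rewrite lt_def sqrf_eq0 t0 sqr_ge0.
nra.
Qed.

(** The inducing representation must act on a [hilbertType], so the subspace becomes a type [hsub];
    its completeness comes from closedness. *)
Record csubspace := CSubspace {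
  csub_set :> set H; csub_closed : closed csub_set; csub_submod : submod csub_set }.

Variable W : csubspace.

Definition csub_pred : pred H := fun v => `[< csub_set W v >].

Record hsub := HSub { hsub_val :> H; _ : csub_pred hsub_val }.

HB.instance Definition _ := [isSub for hsub_val].
HB.instance Definition _ := [Choice of hsub by <:].

Lemma csub_pred_closed : subsemimod_closed csub_pred.
Proof.
have sW := csub_submod W; split; [split|].
- by apply/asboolP; exact: submod0.
- by move=> u v /asboolP Wu /asboolP Wv; apply/asboolP; exact: submodD.
- by move=> a v /asboolP Wv; apply/asboolP; exact: submodZ.
Qed.

HB.instance Definition _ := GRing.SubChoice_isSubLmodule.Build C H csub_pred hsub
  csub_pred_closed.

Lemma hsubP (v : hsub) : csub_set W v.
Proof. by case: v => v /= /asboolP. Qed.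

Lemma hsub_ex v : csub_set W v -> exists v' : hsub, v' = v :> H.
Proof. by move=> /asboolP Wv; exists (HSub Wv). Qed.

Definition hsub_norm (v : hsub) : C := `|hsub_val v|.

Lemma hsub_normD (u v : hsub) : hsub_norm (u + v) <= hsub_norm u + hsub_norm v.
Proof. exact: ler_normD. Qed.

Lemma hsub_normZ (a : C) (v : hsub) : hsub_norm (a *: v) = `|a| * hsub_norm v.
Proof. exact: normrZ. Qed.

Lemma hsub_norm_eq0 (v : hsub) : hsub_norm v = 0 -> v = 0.
Proof. by move=> v0; apply/val_inj/normr0_eq0. Qed.

HB.instance Definition _ :=
  Lmodule_isNormed.Build C hsub hsub_normD hsub_normZ hsub_norm_eq0.

Lemma hsub_complete (F : set_system hsub) : ProperFilter F -> cauchy F -> cvg F.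
Proof.
move=> FF cF; pose G : set_system H := hsub_val @ F.
have FG : ProperFilter G by exact: fmap_proper_filter.
have cG : cauchy G.
  apply: cauchy_exP => e e0; have [v Fv] := (cauchyP F).1 cF e e0.
  exists (hsub_val v); rewrite /G/=; apply: filterS Fv => u.
  by rewrite -!ball_normE.
have /cvg_ex[l Gl] := @cauchy_cvg _ G FG cG.
have Wl : csub_set W l.
  apply: closed_nrm; first exact: csub_closed.
  move=> e e0; have : nbhs l [set v | nrm (v - l) < e] by apply/nbhs_nrm; exists e.
  move=> /Gl Fl; have : F [set v | nrm (hsub_val v - l) < e] by exact: Fl.
  by move=> /filter_ex[v vl]; exists (hsub_val v) => //; exact: hsubP.
have [l' l'E] := hsub_ex Wl; apply/cvg_ex; exists l' => A /=.
rewrite -nbhs_ballE => -[e /= e0 eA].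
have : nbhs l (ball l e) by apply: nbhsx_ballx.
move=> /Gl Fl; have {}Fl : F [set v | ball l e (hsub_val v)] by exact: Fl.
apply: (filterS _ Fl) => v vl; apply: eA.
by move: vl; rewrite -l'E /= -!ball_normE.
Qed.

HB.instance Definition _ := Uniform_isComplete.Build hsub hsub_complete.

Definition hsub_inner (u v : hsub) : C := inner (hsub_val u) (hsub_val v).

Lemma hsub_inner_bilinear :
  bilinear_for *%R (Num.conj \; *%R) hsub_inner.
Proof.
split=> [v a x y|v a x y].
  exact: linearPl.
exact: linearPr.
Qed.
HB.instance Definition _ :=
  bilinear_isBilinear.Build C hsub hsub C *%R (Num.conj \; *%R) hsub_inner
    hsub_inner_bilinear.

Lemma hsub_inner_herm (u v : hsub) :
  hsub_inner u v = (-1) ^+ false * Num.conj (hsub_inner v u).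
Proof. by rewrite /hsub_inner [LHS](@hermC _ false (@Num.conj C)). Qed.

HB.instance Definition _ :=
  isHermitianSesquilinear.Build C hsub false Num.conj hsub_inner hsub_inner_herm.

Lemma hsub_inner_gt0 (u : hsub) : u != 0 -> 0 < hsub_inner u u.
Proof. by move=> u0; exact: neq0_dnorm_gt0. Qed.

HB.instance Definition _ := isDotProduct.Build C hsub hsub_inner hsub_inner_gt0.

Lemma hsub_sqr_norm (v : hsub) : `|v| ^+ 2 = hsub_inner v v.
Proof. exact: sqr_norm_inner. Qed.

HB.instance Definition _ := isHilbert.Build K hsub hsub_sqr_norm.

Lemma inner_hsub (u v : hsub) : inner u v = inner (hsub_val u) (hsub_val v).
Proof. by []. Qed.

End Subspace.

(** * Series of pairwise orthogonal vectors *)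

Section OrthogonalSums.
Variables (K : realType) (H : hilbertType K) (X : choiceType).
Implicit Types (s t : seq X).

Lemma esum_seq_ge (a : X -> K) s : (forall x, 0 <= a x) -> uniq s ->
  ((\sum_(x <- s) a x)%:E <= \esum_(x in [set: X]) (a x)%:E)%E.
Proof.
move=> a0 us; apply: esum_ge; exists [set` s].
  by split=> //; exact: finite_seq.
by rewrite -fsbig_seq// sumEFin.
Qed.

Lemma esum_seq_le (a : X -> K) M :
  (forall s, uniq s -> \sum_(x <- s) a x <= M) ->
  (\esum_(x in [set: X]) (a x)%:E <= M%:E)%E.
Proof.
move=> aM; apply: ge_ereal_sup => _ [A [fA _] <-].
by rewrite fsbig_finite// sumEFin lee_fin; apply: aM; exact: finmap.fset_uniq.
Qed.

Variable f : X -> H.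
Hypothesis f_orth : forall x y, x != y -> rip (f x) (f y) = 0.

Lemma nrm_orth_sum s : uniq s ->
  nrm (\sum_(x <- s) f x) ^+ 2 = \sum_(x <- s) nrm (f x) ^+ 2.
Proof.
elim: s => [_|x s IH /andP[xs us]]; first by rewrite !big_nil nrm0 expr0n.
rewrite !big_cons nrmD_sqr IH// rip_sumr [X in 2 * X]big1_seq ?mulr0 ?addr0// => y /= ys.
by apply: f_orth; apply: contraNneq xs => ->.
Qed.

(** The hypotheses say that [M] is the supremum of the partial sums of squared norms. Partial sums
    of [f] whose squared norm is within [e] of [M] form a Cauchy filter, and [l] is its limit; the
    last clause identifies the components of [l]. *)
Lemma orth_series M :
    (forall s, uniq s -> \sum_(x <- s) nrm (f x) ^+ 2 <= M) ->
    (forall e, 0 < e -> exists2 s, uniq s & M - e <= \sum_(x <- s) nrm (f x) ^+ 2) ->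
  exists l, nrm l ^+ 2 <= M /\
    forall x u, (forall y, y != x -> rip (f y) u = 0) -> rip l u = rip (f x) u.
Proof.
move=> fM fMe; pose a x := nrm (f x) ^+ 2.
have a0 x : 0 <= a x by exact: sqr_ge0.
pose S e := [set v | exists s, [/\ uniq s, v = \sum_(x <- s) f x &
  M - e <= \sum_(x <- s) a x]].
(* The union of [s] and [t] still has sum at most [M], which leaves at most [e] for the part outside
   [s]. *)
have diff e s t : uniq s -> uniq t -> M - e <= \sum_(x <- s) a x ->
    nrm (\sum_(x <- t | x \notin s) f x) ^+ 2 <= e.
  move=> us ut se; rewrite -big_filter nrm_orth_sum ?filter_uniq//.
  have : uniq (s ++ [seq x <- t | x \notin s]).
    rewrite cat_uniq us filter_uniq// andbT; apply/hasPn => x.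
    by rewrite mem_filter => /andP[].
  by move=> /fM; rewrite big_cat /= -/a; move: se; rewrite /a; lra.
have [||d d0|l Sl] := @cauchy_basis _ H S.
- by move=> e /fMe[s us se]; exists (\sum_(x <- s) f x), s.
- by move=> d e de v [s [us -> sd]]; exists s; split=> //; lra.
(* The difference of two partial sums splits into two pieces with squared norm at most [d ^+ 2 / 8];
   the square of the sum of their norms is then at most [d ^+ 2 / 2]. *)
- exists (d ^+ 2 / 8); first by rewrite divr_gt0// exprn_gt0.
  move=> _ _ [s [us -> se]] [t [ut -> te]].
  have -> : \sum_(x <- s) f x - \sum_(x <- t) f x =
      \sum_(x <- s | x \notin t) f x - \sum_(x <- t | x \notin s) f x.
    have E : \sum_(x <- s | x \in t) f x = \sum_(x <- t | x \in s) f x.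
      rewrite -[LHS]big_filter -[RHS]big_filter; apply: perm_big.
      by apply: uniq_perm; rewrite ?filter_uniq// => x; rewrite !mem_filter andbC.
    rewrite (bigID [in t])/= [X in _ - X](bigID [in s])/= E.
    by rewrite opprD addrACA subrr add0r.
  have := diff _ _ _ us ut se; have := diff _ _ _ ut us te.
  have arith (p r : K) : 0 <= p -> 0 <= r -> p ^+ 2 <= d ^+ 2 / 8 ->
      r ^+ 2 <= d ^+ 2 / 8 -> p + r < d.
    move=> p0 r0 pd rd; rewrite -(@ltr_pXn2r _ 2)// ?nnegrE ?addr_ge0 ?(ltW d0)//.
    have : 0 <= (p - r) ^+ 2 by exact: sqr_ge0.
    have : 0 < d ^+ 2 by exact: exprn_gt0.
    by rewrite sqrrB sqrrD !mulr2n; lra.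
  move=> rd pd; apply: le_lt_trans (nrmD _ _) _; rewrite nrmN.
  by apply: arith => //; exact: nrm_ge0.
exists l; split=> [|x u xu].
  have M0 : 0 <= M by have := fM [::] isT; rewrite big_nil.
  rewrite -(sqr_sqrtr M0) ler_pXn2r// ?nnegrE ?nrm_ge0 ?sqrtr_ge0//.
  apply/ler_addgt0Pl => d /Sl[e e0 Se]; have [s us se] := fMe e e0.
  have : nrm (\sum_(x <- s) f x - l) < d by apply: Se; exists s.
  have : nrm (\sum_(x <- s) f x) <= Num.sqrt M.
    rewrite -(@ler_pXn2r _ 2)// ?nnegrE ?nrm_ge0 ?sqrtr_ge0// sqr_sqrtr//.
    by rewrite nrm_orth_sum// fM.
  have := nrmD (l - \sum_(x <- s) f x) (\sum_(x <- s) f x).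
  by rewrite subrK nrmB; lra.
apply/eqP; rewrite -subr_eq0 -normr_le0; apply/ler_addgt0Pl => d d0.
rewrite addr0; have nu : 0 < nrm u + 1 by rewrite ltr_wpDl// nrm_ge0.
have [e e0 Se] := Sl _ (divr_gt0 d0 nu); have [s us se] := fMe e e0.
(* Once [x] occurs in the partial sum, its pairing with [u] is exactly [rip (f x) u]. *)
pose t := if x \in s then s else x :: s.
have xt : x \in t by rewrite /t; case: ifP => // _; rewrite mem_head.
have ut : uniq t by rewrite /t; case: ifP => //= ->.
have te : M - e <= \sum_(y <- t) a y.
  by rewrite /t; case: ifP => // _; rewrite big_cons (le_trans se)// lerDr.
have -> : rip (f x) u = rip (\sum_(y <- t) f y) u.
  rewrite ripC [RHS]ripC rip_sumr (bigD1_seq x)//= big1 ?addr0// => y yx.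
  by rewrite ripC xu.
rewrite -ripBl; apply: le_trans (rip_le _ _) _; rewrite nrmB.
have : nrm (\sum_(y <- t) f y - l) < d / (nrm u + 1) by apply: Se; exists t.
rewrite ltr_pdivlMr//; have := nrm_ge0 u.
by have := nrm_ge0 (\sum_(y <- t) f y - l); nra.
Qed.

End OrthogonalSums.

(** * Induced representations *)

Section SubspaceProjection.
Variables (K : realType) (H : hilbertType K) (W : csubspace H).
Local Notation C := K[i].

Lemma hsub_rip_inj (u v : hsub W) :
  (forall w : hsub W, rip (hsub_val u) (hsub_val w) = rip (hsub_val v) (hsub_val w)) ->
  u = v.
Proof.
move=> uv; apply/eqP; rewrite -subr_eq0; apply/eqP/nrm_eq0/eqP.
rewrite -sqrf_eq0 -ripvv -[rip _ _]/(rip (hsub_val u - hsub_val v) (hsub_val (u - v))).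
by rewrite ripBl uv subrr.
Qed.

(** The inner products with vectors of [W] determine the projected vector, and linearity follows
    from this uniqueness. *)
Lemma hsub_projection : exists P : {linear H -> hsub W},
  forall v (u : hsub W), rip (hsub_val (P v)) (hsub_val u) = rip v (hsub_val u).
Proof.
have /choice[p pE] v : exists w : hsub W,
    forall u : hsub W, rip (hsub_val w) (hsub_val u) = rip v (hsub_val u).
  have [w Ww wP] := orthogonal_projection v (csub_closed (c := W)) (csub_submod W).
  have [w' w'E] := hsub_ex Ww; exists w' => u.
  have := wP _ (hsubP u); rewrite ripBl w'E => /eqP.
  by rewrite subr_eq0 => /eqP.
have pL : linear p.
  move=> a u v; apply: hsub_rip_inj => w; rewrite pE.
  rewrite -[hsub_val (_ + _)]/(a *: hsub_val (p u) + hsub_val (p v)).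
  rewrite !ripDl pE !ripZ; congr (_ + _).
  by rewrite -[_ *: hsub_val w]/(hsub_val ((a^*)%C *: w)) pE.
pose P : {linear H -> hsub W} := HB.pack p (GRing.isLinear.Build _ _ _ _ p pL).
by exists P.
Qed.

Variable P : {linear H -> hsub W}.
Hypothesis PE :
  forall v (u : hsub W), rip (hsub_val (P v)) (hsub_val u) = rip v (hsub_val u).

Lemma projection_id (w : hsub W) : P (hsub_val w) = w.
Proof. by apply: hsub_rip_inj => u; rewrite PE. Qed.

Lemma projection_nrm v : nrm (hsub_val (P v)) <= nrm v.
Proof.
have [->|P0] := eqVneq (nrm (hsub_val (P v))) 0; first exact: nrm_ge0.
have Pgt : 0 < nrm (hsub_val (P v)) by rewrite lt_def P0 nrm_ge0.
rewrite -(ler_pM2r Pgt) -expr2 -ripvv PE.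
exact: le_trans (ler_norm _) (rip_le _ _).
Qed.

End SubspaceProjection.

(** * A criterion for being induced from an invariant subspace of a subgroup *)

Section InductionCriterion.
Variables (K : realType) (G : topGroupType) (H : hilbertType K).
Variable rho : G -> {linear H -> H}.
Hypotheses (rhoU : unitary_rep setT rho) (rhoI : irreducible rho).

Lemma rho1 v : rho 1%g v = v. Proof. by case: rhoU. Qed.
Lemma rhoM g h v : rho (g * h)%g v = rho g (rho h v).
Proof. by case: rhoU => _ + _ _; apply. Qed.
Lemma rhoVK g v : rho g (rho (g^-1)%g v) = v.
Proof. by rewrite -rhoM mulgV rho1. Qed.
Lemma rho_rip g u v : rip (rho g u) (rho g v) = rip u v.
Proof. by rewrite /rip; case: rhoU => _ _ -> //. Qed.
Lemma rho_nrm g v : nrm (rho g v) = nrm v.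
Proof.
apply/eqP; rewrite -(@eqrXn2 _ 2)// ?nrm_ge0//; apply/eqP.
by rewrite -!ripvv rho_rip.
Qed.
Lemma rho_ripV g u v : rip (rho g u) v = rip u (rho (g^-1)%g v).
Proof. by rewrite -[v in LHS](rhoVK g) rho_rip. Qed.
Lemma rho_continuous v : continuous (fun g => rho g v).
Proof. by apply/continuous_subspace_setT; case: rhoU. Qed.

Variables (Q : set G) (W : csubspace H).
Hypotheses (Qg : subgroup Q) (W0 : exists2 w, csub_set W w & w != 0).
Hypothesis WQ : forall q w, Q q -> csub_set W w -> csub_set W (rho q w).
Hypothesis Worth : forall g u w, ~ Q g -> csub_set W u -> csub_set W w ->
  rip u (rho g w) = 0.

Lemma coset_cocycleP g (x : cosets Q) : Q (coset_cocycle g x).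
Proof.
have [Q1 _ _] := Qg; rewrite /coset_cocycle.
have repE y : [set (q * @coset_rep _ Q y)%g | q in Q] = val y.
  by rewrite /coset_rep; case: cid.
have : val (coset_mul x g) (coset_rep x * g)%g.
  by exists (coset_rep x) => //; rewrite -repE; exists 1%g => //; rewrite mul1g.
by rewrite -repE => -[q Qq <-]; rewrite mulgK.
Qed.

Lemma coset_rep_mul g (x : cosets Q) :
  (coset_rep x * g)%g = (coset_cocycle g x * coset_rep (coset_mul x g))%g.
Proof. by rewrite /coset_cocycle mulgVK. Qed.

Lemma coset_rep_inj (x y : cosets Q) :
  Q (coset_rep x * (coset_rep y)^-1)%g -> x = y.
Proof.
have [_ QM QV] := Qg => Qxy.
have repE z : [set (q * @coset_rep _ Q z)%g | q in Q] = val z.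
  by rewrite /coset_rep; case: cid.
apply: val_inj => /=; rewrite -!repE.
apply/seteqP; split=> _ [q Qq <-].
  exists (q * (coset_rep x * (coset_rep y)^-1))%g; first exact: QM.
  by rewrite -!mulgA mulVg mulg1.
exists (q * (coset_rep x * (coset_rep y)^-1)^-1)%g; first exact/QM/QV.
by rewrite invgM invgK -!mulgA mulVg mulg1.
Qed.

Lemma coset_rep_ex g : exists q (x : cosets Q), Q q /\ g = (q * coset_rep x)%g.
Proof.
have [Q1 _ _] := Qg.
have xP : [set (q * g)%g | q in Q] \in cosets Q by apply/mem_set; exists g.
pose x : cosets Q := SigSub xP.
have repE : [set (q * @coset_rep _ Q x)%g | q in Q] = val x.
  by rewrite /coset_rep; case: cid.
have : val x g by exists 1%g => //; rewrite mul1g.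
by rewrite -repE => -[q Qq <-]; exists q, x.
Qed.

(** By [Worth] the translates of [W] by the inverses of the [coset_rep x] are pairwise orthogonal.
    [T v x] is the component of [v] in such a translate, carried back to [W]. Irreducibility makes
    [T] injective, orthogonal series make it onto, and Bessel's inequality together with these two
    makes it isometric. *)
Lemma induced_criterion : exists nu : G -> {linear hsub W -> hsub W},
  [/\ unitary_rep Q nu,
      forall g v, Q g -> hsub_val (nu g v) = rho g (hsub_val v) &
      induced_from Q nu rho].
Proof.
have [Q1 QM QV] := Qg; have [P PE] := hsub_projection W.
(* Since [Q] preserves [W], it preserves the orthogonal complement, so the part of [v] outside [W]
   does not contribute. *)
have PQ q v : Q q -> P (rho q v) = P (rho q (hsub_val (P v))).
  move=> Qq; apply: hsub_rip_inj => u; rewrite !PE !rho_ripV.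
  have [u' u'E] := hsub_ex (WQ (QV _ Qq) (hsubP u)).
  by rewrite -u'E PE.
have PW w : csub_set W w -> hsub_val (P w) = w.
  by move=> /hsub_ex[w' <-]; rewrite projection_id.
(* Composing with [P] gives a value for every [g]; on [Q] it is the restriction of [rho]. *)
pose nuf g (v : hsub W) := P (rho g (hsub_val v)).
have nuL g : linear (nuf g).
  move=> a u v; rewrite /nuf -[hsub_val (_ + _)]/(a *: hsub_val u + hsub_val v).
  by rewrite !linearP.
pose nu g : {linear hsub W -> hsub W} :=
  HB.pack (nuf g) (GRing.isLinear.Build _ _ _ _ (nuf g) (nuL g)).
have nuE g v : nu g v = P (rho g (hsub_val v)) by [].
have nuQ g v : Q g -> hsub_val (nu g v) = rho g (hsub_val v).
  by move=> Qq; rewrite nuE PW//; apply: WQ => //; exact: hsubP.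
exists nu; split=> //.
- split=> [v|g h v Qq Qh|g u v Qq|v].
  + by rewrite nuE rho1 projection_id.
  + by rewrite !nuE rhoM PQ.
  + by rewrite !inner_hsub !nuQ//; case: rhoU => _ _ ->.
  + apply: continuous_subspaceT => g A /nbhs_nrm[e e0 eA].
    have : nbhs (rho g (hsub_val v)) [set u | nrm (u - rho g (hsub_val v)) < e].
      by apply/nbhs_nrm; exists e.
    move=> /rho_continuous Fg.
    have {}Fg : nbhs g
        [set h | nrm (rho h (hsub_val v) - rho g (hsub_val v)) < e] by exact: Fg.
    apply: (filterS _ Fg) => h hg; apply: eA; rewrite !nuE -linearB; apply: le_lt_trans hg.
    exact: projection_nrm.
pose Tf v : cosets Q -> hsub W := fun x => P (rho (coset_rep x) v).
have TL : linear Tf.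
  by move=> a u v; apply/funext => x; rewrite /Tf !linearP.
pose T : {linear H -> (cosets Q -> hsub W)} :=
  HB.pack Tf (GRing.isLinear.Build _ _ _ _ Tf TL).
have TE v x : T v x = P (rho (coset_rep x) v) by [].
(* The vectors all of whose translates are killed by [P] form a closed invariant subspace; it is
   proper because [W] is nonzero, so it is zero. *)
have TI v : (forall x, T v x = 0) -> v = 0.
  move=> Tv0; pose N := [set v | forall g, P (rho g v) = 0].
  have Nv : N v.
    move=> g; have [q [x [Qq ->]]] := coset_rep_ex g.
    by rewrite rhoM PQ// -TE Tv0 !linear0.
  have [_ /(_ N) NE] := rhoI; case: NE => [||a u w Nu Nw|g u Nu||NT].
  - apply: nrm_closed => u uN g; apply: hsub_rip_inj => w.
    rewrite PE rip0l; apply/eqP; rewrite -normr_le0; apply/ler_addgt0Pl => e e0.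
    rewrite addr0; have nw : 0 < nrm (hsub_val w) + 1 by rewrite ltr_wpDl// nrm_ge0.
    have [u' Nu' uu'] := uN _ (divr_gt0 e0 nw).
    have -> : rip (rho g u) (hsub_val w) = rip (rho g (u - u')) (hsub_val w).
      by rewrite linearB/= ripBl -[rip (rho g u') _]PE Nu' rip0l subr0.
    apply: le_trans (rip_le _ _) _; rewrite rho_nrm nrmB.
    move: uu'; rewrite ltr_pdivlMr//; have := nrm_ge0 (hsub_val w).
    by have := nrm_ge0 (u' - u); nra.
  - by move=> g; rewrite !linear0.
  - by move=> g; rewrite linearP linearP /= Nu Nw scaler0 addr0.
  - by move=> h; rewrite -rhoM.
  - by move=> N0; move: Nv; rewrite N0.
  - have [w Ww w0] := W0; have : N w by rewrite NT.
    move=> /(_ 1%g); rewrite rho1 => /(congr1 (@hsub_val _ _ _)).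
    by rewrite PW// => w00; move: w0; rewrite w00 eqxx.
(* The value at [x] placed back into its translate of [W]; summing these over [x] inverts [T]. *)
pose F (h : cosets Q -> hsub W) x := rho (coset_rep x)^-1%g (hsub_val (h x)).
have FO h x y : x != y -> rip (F h x) (F h y) = 0.
  move=> xy; rewrite /F rho_ripV -rhoM invgK; apply: Worth; try exact: hsubP.
  by move=> /coset_rep_inj /eqP; rewrite (negPf xy).
have FN h x : nrm (F h x) = nrm (h x) by rewrite rho_nrm.
have esumE h : ell2_sqnorm h = (\esum_(x in [set: cosets Q]) (nrm (F h x) ^+ 2)%:E)%E.
  by apply: eq_esum => x _; rewrite FN.
have bessel v s : uniq s -> \sum_(x <- s) nrm (F (T v) x) ^+ 2 <= nrm v ^+ 2.
  move=> us; have := sqr_ge0 (nrm (v - \sum_(x <- s) F (T v) x)).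
  rewrite nrmB_sqr nrm_orth_sum//; last exact: FO.
  have -> : rip v (\sum_(x <- s) F (T v) x) = \sum_(x <- s) nrm (F (T v) x) ^+ 2.
    rewrite rip_sumr; apply: eq_bigr => x _.
    by rewrite FN -ripvv ripC rho_ripV invgK ripC -[LHS]PE.
  by rewrite mulr2n mulrDl mul1r opprD addrA addrK subr_ge0.
have surj h : ell2 h -> exists l, T l = h /\ ((nrm l ^+ 2)%:E <= ell2_sqnorm h)%E.
  move=> hfin; have := hfin; rewrite /ell2 /=.
  have h0 : (0 <= ell2_sqnorm h)%E.
    by apply: esum_ge0 => x _; rewrite lee_fin sqr_ge0.
  case hM : (ell2_sqnorm h) h0 => [M| |]// _ _.
  have [s us|e e0|l [lM lE]] := orth_series (FO h) (M := M).
  - by rewrite -lee_fin -hM esumE; apply: esum_seq_ge => // x; exact: sqr_ge0.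
  - apply: contrapT => Me.
    suff : (ell2_sqnorm h <= (M - e)%:E)%E by rewrite hM lee_fin; lra.
    rewrite esumE; apply: esum_seq_le => s us; rewrite leNgt; apply/negP => sM.
    by apply: Me; exists s => //; exact: ltW.
  exists l; rewrite lee_fin; split=> //; apply/funext => x.
  apply: hsub_rip_inj => u.
  rewrite -[X in rip X _]/(hsub_val (P (rho (coset_rep x) l))) PE rho_ripV (lE x) => [|y yx].
    by rewrite /F rho_rip.
  rewrite /F rho_ripV -rhoM invgK; apply: Worth; try exact: hsubP.
  by move=> /coset_rep_inj /eqP; rewrite (negPf yx).
have Tle v : (ell2_sqnorm (T v) <= (nrm v ^+ 2)%:E)%E.
  by rewrite esumE; apply: esum_seq_le => s; exact: bessel.
have Tell2 v : ell2 (T v).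
  by rewrite /ell2/=; apply: le_lt_trans (Tle v) _; rewrite ltry.
exists T; split.
- apply/seteqP; split=> [_ [v _ <-]|h /surj[l [<- _]]]; [exact: Tell2 | by exists l].
- move=> v; apply/eqP; rewrite eq_le; apply/andP; split; first exact: Tle.
  (* The preimage given by [surj] satisfies the inequality opposite to Bessel's, and by injectivity
     it is [v]. *)
  have [l [Tl]] := surj _ (Tell2 v).
  have -> // : l = v.
  apply/eqP; rewrite -subr_eq0; apply/eqP/TI => x.
  by rewrite linearB -[LHS]/(T l x - T v x) Tl subrr.
- move=> g v; apply/funext => x.
  rewrite /ind_act nuE !TE -rhoM coset_rep_mul rhoM PQ//.
  exact: coset_cocycleP.
Qed.

End InductionCriterion.

(** * Vectors fixed by pointwise stabilizers, and the inducing submodule *)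

Section Main.
Variables (q : nat) (q_gt1 : (1 < q)%N) (K : realType) (H : hilbertType K).
Local Notation A := 'Z_q.
Variable rho : rfGL A -> {linear H -> H}.
Hypotheses (rhoU : unitary_rep setT rho) (rhoI : irreducible rho).

Definition fixed (L : set (fseq A)) : set H :=
  [set v | forall g, ptstab L g -> rho g v = v].

Lemma fixed_submod L : submod (fixed L).
Proof.
split=> [g _|a u v uL vL g gL]; first exact: linear0.
by rewrite linearP/= uL// vL.
Qed.

Lemma fixed_closed L : closed (fixed L).
Proof.
apply: nrm_closed => v vL g gL; apply/eqP; rewrite -subr_eq0.
apply/eqP/nrm_eq0/eqP; rewrite eq_le nrm_ge0 andbT; apply/ler_addgt0Pl => e e0.
have e2 : 0 < e / 2 by rewrite divr_gt0.
have [u uL uv] := vL _ e2; apply: le_trans (nrm_tri u _ _) _.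
rewrite -{1}(uL _ gL) -linearB (rho_nrm rhoU) (nrmB v u).
by move: uv; lra.
Qed.

Definition fixed_csubspace L := CSubspace (@fixed_closed L) (fixed_submod L).

Lemma ptstab1 L : ptstab L (1%g : rfGL A).
Proof. by move=> v _; rewrite vmulg1. Qed.

Lemma ptstabM L (g h : rfGL A) : ptstab L g -> ptstab L h -> ptstab L (g * h)%g.
Proof. by move=> gL hL v Lv; rewrite vmulgM gL// hL. Qed.

Lemma ptstabV L (g : rfGL A) : ptstab L g -> ptstab L (g^-1)%g.
Proof. by move=> gL v Lv; rewrite -{1}(gL v Lv) vmulgK. Qed.

(** The inverses appear because matrices act on row vectors from the right: it is [g * h^-1] that
    fixes [L] pointwise. *)
Lemma fixed_eq L (g h : rfGL A) v : fixed L v ->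
  (forall l, L l -> vmul l g = vmul l h) -> rho (g^-1)%g v = rho (h^-1)%g v.
Proof.
move=> vL gh; have /vL E : ptstab L (g * h^-1)%g.
  by move=> l Ll; rewrite vmulgM gh// vmulgK.
by rewrite -{1}E -(rhoM rhoU) mulgA mulVg mul1g.
Qed.

Definition orbit L v := [set rho g v | g in ptstab L].

(** The point of minimal norm serves in place of an average over the stabilizer. *)
Lemma orbit_hull_fixed L v : exists2 a, hull (orbit L v) a & fixed L a.
Proof.
have [||f u [g gL <-] [h hL <-]|a Aa aP] :=
    @hull_fixed _ _ (orbit L v) [set rho g | g in ptstab L].
- by exists v, 1%g; [exact: ptstab1 | rewrite (rho1 rhoU)].
- by move=> _ [g _ <-] u; exact: rho_nrm.
- by exists (g * h)%g; [exact: ptstabM | rewrite (rhoM rhoU)].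
by exists a => // g gL; apply: aP; exists g.
Qed.

(* For generic k the pairing of rho(k^-1) w with a point of the orbit of u is
   the constant <w, u>, while 0 lies in the closed convex hull of that orbit. *)
Lemma fixed_orthogonal L M u w : fin_submod L -> fin_submod M ->
    fixed (L `&` M) `<=` [set 0] -> fixed L u -> fixed M w -> rip w u = 0.
Proof.
move=> fL fM N0 uL wM; pose N := L `&` M.
have sN : submod N by apply: submodI; [case: fL | case: fM].
have [a aA /N0 a0] := orbit_hull_fixed N u; rewrite {}a0 {a} in aA.
pose generic D k := ptstab N k /\ forall m, M m -> supp D (vmul m k) -> N m.
have genericW D E k : (D <= E)%N -> generic E k -> generic D k.
  by move=> DE [kN kE]; split=> // m Mm /(suppW DE) /kE; apply.
(* The points whose pairing with [rho (k^-1) w] tends to [rip w u] as [k] becomes generic; [S] is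
   midpoint-closed, so it contains the hull of the orbit as soon as it contains the orbit. *)
pose S := [set x | forall e, 0 < e -> exists D, forall k, generic D k ->
  `|rip (rho (k^-1)%g w) x - rip w u| <= e].
have mS : midclosed S.
  split=> [|x y Sx Sy e e0].
    apply: nrm_closed => x xS e e0.
    have nw : 0 < 2 * (nrm w + 1) by have := nrm_ge0 w; lra.
    have e2 : 0 < e / 2 by lra.
    have [y Sy yx] := xS _ (divr_gt0 e0 nw); have [D DP] := Sy _ e2.
    exists D => k /DP; set r := rho _ _ => ry.
    have -> : rip r x - rip w u = rip r y - rip w u + rip r (x - y).
      by rewrite ripBr; ring.
    apply: le_trans (ler_normD _ _) _.
    have := rip_le r (x - y); rewrite /r (rho_nrm rhoU) -/r nrmB.
    move: yx; rewrite ltr_pdivlMr//; have := nrm_ge0 w; have := nrm_ge0 (y - x).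
    by move: ry; move: (`|_|) (`|_|) (nrm _) (nrm _) => s t n m; nra.
  have [D DP] := Sx _ e0; have [E EP] := Sy _ e0.
  exists (maxn D E) => k kDE.
  have := DP k (genericW _ _ _ (leq_maxl _ _) kDE).
  have := EP k (genericW _ _ _ (leq_maxr _ _) kDE).
  have -> r : rip r (mid x y) = 2^-1 * (rip r x + rip r y).
    by rewrite ripC /mid ripZr ripDl ![rip _ r]ripC.
  by rewrite !ler_norml; lra.
have orbitS : orbit N u `<=` S.
  move=> _ [g gN <-] e e0.
  (* With [D] bounding the supports in the image of [L] under [g^-1], a generic [k] moves every
     vector of [M] outside [N] off this image. So some [h] agrees with [g^-1] on [L] and with [k] on
     [M], and both vectors in the pairing are translates by [h^-1]. *)
  have [D LD] := fin_submod_bound (fin_submod_vmul (g^-1)%g fL).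
  exists D => k [kN kD].
  have [||l m Ll Mm lm|h [hL hM]] := @amalgam_extends _ q_gt1 L M (g^-1)%g k fL fM.
  - exact: ptstabV.
  - exact: kN.
  - have Nm : N m by apply: kD => //; rewrite -lm; apply: LD; exists l.
    suff -> : l = m by [].
    by rewrite -(vmulgVK g l) lm kN// gN.
  rewrite -(fixed_eq wM hM) -[g in X in `|X - _|]invgK -(fixed_eq uL hL).
  by rewrite (rho_rip rhoU) subrr normr0 ltW.
apply/eqP; rewrite -normr_le0; apply/ler_addgt0Pl => e e0; rewrite addr0.
(* Now 0 lies in [S], so a single generic [k] bounds [rip w u] by [e]. *)
have [D DP] := aA S mS orbitS e e0; have [E ME] := fin_submod_bound fM.
have [k kN kM] := @general_position _ q_gt1 N M (maxn D E) sN (@subIsetr _ L M)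
  (fun v Mv => suppW (leq_maxr D E) (ME v Mv)).
have /DP : generic D k by apply: genericW (leq_maxl D E) _; split.
by rewrite rip0r sub0r normrN.
Qed.

(** By continuity the pointwise stabilizer of some [supp D] moves [v] by less than half its norm.
    The hull of the orbit then stays in a ball around [v] that misses 0, so the fixed vector in it
    is nonzero. *)
Lemma exists_fixed : exists2 L, fin_submod L & exists2 v, fixed L v & v != 0.
Proof.
have [[v v0] _] := rhoI.
have nv : 0 < nrm v / 2.
  rewrite divr_gt0// lt_def nrm_ge0 andbT.
  by apply: contra_neq v0; exact: nrm_eq0.
have : nbhs (rho 1%g v) [set u | nrm (u - rho 1%g v) < nrm v / 2].
  by apply/nbhs_nrm; exists (nrm v / 2).
move=> /(rho_continuous rhoU) /nbhs_rfGL[F FP].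
have [D FD] : exists D, forall u, u \in F -> supp D u.
  elim: F {FP} => [|u F [D FD]]; first by exists 0%N.
  have [E uE] := fseq_bound u; exists (maxn D E) => x.
  rewrite inE => /orP[/eqP->|/FD]; last exact/suppW/leq_maxl.
  exact: (suppW (leq_maxr D E)).
exists (@supp A D); first exact: fin_submod_supp.
have [a aA aL] := orbit_hull_fixed (@supp A D) v; exists a => //.
apply/eqP => a0; have := aA _ (midclosed_ball v (nrm v / 2)).
have : orbit (@supp A D) v `<=` [set u | nrm (u - v) <= nrm v / 2].
  move=> _ [g gL <-] /=; rewrite -{2}(rho1 rhoU v); apply/ltW/FP => u uF.
  by rewrite vmulg1 gL//; exact: FD.
move=> AB /(_ AB) /=; rewrite a0 sub0r nrmN.
by move: nv; lra.
Qed.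

(** [L] has the least number of elements, counted by duplicate-free lists; a proper submodule has
    fewer. *)
Lemma exists_minimal_fixed : exists L, [/\ fin_submod L,
  exists2 v, fixed L v & v != 0 &
  forall M, fin_submod M -> M `<=` L -> M <> L -> fixed M `<=` [set 0]].
Proof.
pose P n := `[< exists s : seq (fseq A), [/\ uniq s, size s = n,
  submod [set v | v \in s] & exists2 v, fixed [set v | v \in s] v & v != 0] >].
have sE L s : (forall v, L v <-> v \in s) -> L = [set v : fseq A | v \in undup s].
  by move=> Ls; apply/seteqP; split=> v /=; rewrite mem_undup => /Ls.
have exP : exists n, P n.
  have [L [sL [s /sE Ls]] vL] := exists_fixed; exists (size (undup s)).
  by apply/asboolP; exists (undup s); rewrite undup_uniq -Ls; split.
case: (ex_minnP exP) => _ /asboolP[s [us <- sL vL]] smin.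
exists [set v | v \in s]; split=> //; first by split=> //; exists s.
move=> M [sM [t /sE Mt]] ML nML v vM /=; apply: contrapT => /eqP v0.
apply: nML; have /smin : P (size (undup t)).
  by apply/asboolP; exists (undup t); rewrite undup_uniq -Mt; split=> //; exists v.
have ts : {subset undup t <= s} by move=> x; move: (ML x); rewrite Mt.
move=> /(uniq_min_size (undup_uniq t) ts)[_ tsE].
by rewrite Mt; apply/seteqP; split=> x /=; rewrite tsE.
Qed.

(** [g] acts injectively, so [L] and its image have equally many elements and the inclusion is an
    equality. *)
Lemma vmul_image_eq L (g : rfGL A) : fin_submod L ->
  L `<=` [set vmul v g | v in L] -> setstab L g.
Proof.
move=> [_ [s sE]] Lg; rewrite /setstab/=.
have gI : injective (fun v : fseq A => vmul v g).
  by move=> u v uv; rewrite -[u](vmulgK g) uv vmulgK.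
have ss : {subset undup s <= [seq vmul v g | v <- undup s]}.
  move=> x; rewrite mem_undup => /sE /Lg[y Ly <-]; apply: map_f.
  by rewrite mem_undup; exact/sE.
have := uniq_min_size (undup_uniq s) ss; rewrite size_map => /(_ (leqnn _))[_ ssE].
apply/seteqP; split=> // _ [v Lv <-]; apply/sE.
by rewrite -mem_undup ssE; apply: map_f; rewrite mem_undup; exact/sE.
Qed.

Lemma induced_of_irreducible : exists (L : set (fseq A)) (V : hilbertType K)
    (nu : rfGL A -> {linear V -> V}),
  [/\ fg_submodule L, unitary_rep (setstab L) nu,
      forall g v, ptstab L g -> nu g v = v & induced_from (setstab L) nu rho].
Proof.
have [L [fL vL Lmin]] := exists_minimal_fixed.
have [_ _ LV] := setstab_subgroup L.
have LP g l : setstab L g -> L l -> L (vmul l g).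
  by rewrite /setstab/= => gL Ll; rewrite -gL; exists l.
have ptL g : ptstab L g -> setstab L g.
  move=> gL; apply/seteqP; split=> [_ [l Ll <-]|l Ll]; first by rewrite gL.
  by exists l => //; exact: gL.
(* The pointwise stabilizer is normalized by the setwise one. *)
have WQ g w : setstab L g -> fixed L w -> fixed L (rho g w).
  move=> gL wL h hL; rewrite -(rhoM rhoU) -[(h * g)%g](mulVKg g) (rhoM rhoU) wL//.
  by move=> l Ll; rewrite !vmulgM hL ?vmulgVK//; apply: LP => //; exact: LV.
(* [rho g w] is fixed by the pointwise stabilizer of the image [M] of [L] under [g^-1]. As [g] does
   not preserve [L], the intersection of [L] and [M] is proper in [L], and by minimality it has no
   nonzero fixed vectors. *)
have Worth g u w : ~ setstab L g -> fixed L u -> fixed L w -> rip u (rho g w) = 0.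
  move=> gL uL wL; pose M := [set vmul l (g^-1)%g | l in L].
  have fM : fin_submod M by exact: fin_submod_vmul.
  have gwM : fixed M (rho g w).
    move=> h hM; rewrite -(rhoM rhoU) -[(h * g)%g](mulVKg g) (rhoM rhoU) wL//.
    by move=> l Ll; rewrite !vmulgM hM ?vmulgVK//; exists l.
  rewrite ripC; apply: (fixed_orthogonal fL fM) => //; apply: Lmin.
  - apply: (fin_submod_sub _ _ fL); first by apply: submodI; [case: fL | case: fM].
    by move=> x [].
  - by move=> x [].
  - move=> LM; apply: gL; rewrite -[g]invgK; apply: LV.
    apply: vmul_image_eq => // l Ll.
    by have [] : (L `&` M) l by rewrite LM.
have [nu [nuU nuE nuI]] := @induced_criterion _ _ _ rho rhoU rhoI (setstab L)
  (fixed_csubspace L) (setstab_subgroup L) vL WQ Worth.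
exists L, (hsub (fixed_csubspace L)), nu; split=> //; first exact: fin_submod_fg.
move=> g v gL; apply: (@val_inj _ _ (hsub (fixed_csubspace L))).
by apply: etrans (nuE g v (ptL _ gL)) _; exact: (hsubP v).
Qed.

End Main.

Theorem proposition1p6 (p n : nat) (p_prime : prime p) (p_gt2 : (2 < p)%N)
    (n_gt0 : (1 <= n)%N) (K : realType) (H : hilbertType K)
    (rho : rfGL 'Z_(p ^ n) -> {linear H -> H}) :
  unitary_rep setT rho -> irreducible rho ->
  exists (L : set (fseq 'Z_(p ^ n))) (V : hilbertType K)
    (nu : rfGL 'Z_(p ^ n) -> {linear V -> V}),
    [/\ fg_submodule L,
        unitary_rep (setstab L) nu,
        forall g v, ptstab L g -> nu g v = v &
        induced_from (setstab L) nu rho].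
Proof.
by apply: induced_of_irreducible; rewrite -(exp1n n) ltn_exp2r// ltnW.
Qed.
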